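(* Let $V$ be a finite set with $n=|V|$, and let $f:2^V\to\mathbb{R}$ be a submodular function with $f(\emptyset)=0$ and $f(V)\le 0$, given by an evaluation oracle. Using $\delta=1/(3n^3)$, the basic strongly polynomial algorithm (described in the context) finds the unique inclusionwise minimal optimal solution to $\min_{S\subseteq V}f(S)$ in time $$O\big(n^2\cdot\mathrm{AO}^{\downarrow}(f,1/(3n^3))+n^4\cdot\mathrm{EO}+n^5\big).$$
   Context: A function $f:2^V\to\mathbb{R}$ is submodular if $f(X)+f(Y)\ge f(X\cap Y)+f(X\cup Y)$ for all $X,Y\subseteq V$. $\mathrm{EO}$ is the time of one evaluation of $f$; running time counts arithmetic operations on numbers plus $\mathrm{EO}$ per evaluation. For $z\in\mathbb{R}^V$, $S\subseteq V$: $z(S)=\sum_{v\in S}z(v)$, $z^-(v)=\min\{0,z(v)\}$, $z^-(S)=\sum_{v\in S}z^-(v)$. For $h$ submodular with $h(\emptyset)=0$, $B(h)=\{x: x(S)\le h(S)\ \forall S\subseteq V,\ x(V)=h(V)\}$, $L_h=\max\{\|z\|_1: z\in B(h)\}$. Extreme bases (vertices) of $B(h)$ are the points $x(v_i)=h(\{v_1,\dots,v_i\})-h(\{v_1,\dots,v_{i-1}\})$ for orderings $v_1,v_2,\dots$ of the ground set. Oracle Approx-SFM. Input: a submodular function $h$ and $\delta>0$. Output: a set $W$ and a vector $y\in B(h)$, given as a convex combination of $O(n)$ extreme bases of $B(h)$ ($n$ being the size of the ground set), with $h(W)\le y^-(V)+\delta L_h$. $\mathrm{AO}(h,\delta)$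 denotes its running time. Ring families. The algorithm maintains a digraph $D=(V,F)$ on the current ground set, kept transitive and acyclic between main iterations. Write $u\preceq v$ if there is a directed path (possibly trivial) from $v$ to $u$ in $F$. Let $v^{\downarrow}=\{u:u\preceq v\}$, $v^{\uparrow}=\{u:v\preceq u\}$, $X^{\downarrow}=\bigcup_{v\in X}v^{\downarrow}$, $X^{\uparrow}=\bigcup_{v\in X}v^{\uparrow}$, and $\mathcal{F}=\{X\subseteq V:\text{no arc of }F\text{ leaves }X\}$. Define $\ell(v)=f((V\setminus v^{\uparrow})\cup\{v\})-f(V\setminus v^{\uparrow})$ and $f^{\downarrow}(X)=f(X^{\downarrow})-\ell^-(X^{\downarrow}\setminus X)$ for $X\subseteq V$ (a submodular function on $2^V$). $\mathrm{AO}^{\downarrow}(f,\delta)$ is the maximum of $\mathrm{AO}(f^{\downarrow},\delta)$ over all possible choices of ring families $\mathcal{F}$ (including the contracted functions arising in the algorithm). $\mathrm{Push}(g,h,S)$: for an extreme base $g$ of $B(h)$ given by an ordering, return the extreme base of $B(h)$ of the ordering obtained by moving all elements of $V\setminus S$ before all elements of $S$, keeping the relative orders inside $V\setminus S$ and inside $S$. The basic strongly polynomial algorithm (input $f$ with $f(V)\le0$, and $\delta>0$). Initialize $F:=\emptyset$, $T:=\emptyset$. While $\ell^-(V)<0$: (1) Call Approx-SFM$(f^{\downarrow},\delta)$ to obtain $W$ and $y=\sum_{i=1}^kx_ig_i\in B(f^{\downarrow})$, a convex combination of extreme bases. (2) For every $z\in V$ with $f(V\setminus z^{\uparrow})>-|V|\cdot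 y^-(V\setminus z^{\uparrow})$: set $g_i':=\mathrm{Push}(g_i,f^{\downarrow},z^{\uparrow})$ for $i=1,\dots,k$ and $y':=\sum_ix_ig_i'$; for every $v\in V\setminus z^{\uparrow}$ with $y'(v)>-y'^-(V\setminus z^{\uparrow})$ add the arc $(v,z)$ to $F$. (3) For every $v\in V$ with $y(v)<2\ell^-(V)\delta$: replace $f$ by $S\mapsto f(S\cup v^{\downarrow})-f(v^{\downarrow})$ on the ground set $V:=V\setminus v^{\downarrow}$; then set $f(V):=\min\{0,f(V)\}$ and $T:=T\cup v^{\downarrow}$. (4) Contract every strongly connected component $C$ of $F$ to a single node $v_C$, i.e. replace $V$ by $(V\setminus C)\cup\{v_C\}$ and $f$ by $f'$ with $f'(S)=f(S)$ if $v_C\notin S$, $f'(S)=f((S\setminus\{v_C\})\cup C)$ if $v_C\in S$; replace $F$ by its transitive closure. Return the pre-image of $T$ in the original ground set. Here $n$ always denotes the size of the original ground set, while $|V|$ is the size of the current one. *)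

(* Defs.v *)
From HB Require Import structures.
From mathcomp Require Import all_boot all_order all_algebra.
From mathcomp Require Import constructive_ereal reals ereal.

Set Implicit Arguments.
Unset Strict Implicit.
Unset Printing Implicit Defensive.
Import Order.TTheory GRing.Theory Num.Theory.
Local Open Scope ring_scope.

(* A ground set is a subset G of a finite type T.  A vector of R^G is a finite
   function on T of which only the coordinates in G are used, and a set function
   on 2^G is a function on {set T} of which only the values at subsets of G are
   used. *)

Section SubmodularFunctions.
Variables (R : realType) (T : finType).
Implicit Types (G U S W X Y : {set T}) (h : {set T} -> R) (x : {ffun T -> R}).

Definition submodular G h :=
  forall X Y, X \subset G -> Y \subset G ->
    h (X :&: Y) + h (X :|: Y) <= h X + h Y.

Definition neg_sum x U : R := \sum_(v in U) Num.min 0 (x v).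

Definition base_polytope G h x : Prop :=
  (forall S, S \subset G -> \sum_(v in S) x v <= h S) /\
  \sum_(v in G) x v = h G.

Definition max_norm G h : R :=
  sup (fun r : R => exists2 x, base_polytope G h x & r = \sum_(v in G) `|x v|).

Definition before (s : seq T) (v : T) : {set T} := [set u in take (index v s) s].

Definition upto (s : seq T) (v : T) : {set T} :=
  [set u in take (index v s).+1 s].

Definition extreme_base h (s : seq T) : {ffun T -> R} :=
  [ffun v => h (upto s v) - h (before s v)].

(* Push acts on the ordering that defines an extreme base. *)
Definition push (s : seq T) S : seq T :=
  [seq v <- s | v \notin S] ++ [seq v <- s | v \in S].

Definition minimizer h S := forall X, h S <= h X.

Definition minimal_minimizer h S :=
  minimizer h S /\ forall X, minimizer h X -> X \subset S -> X = S.

End SubmodularFunctions.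

Section Digraphs.
Variable T : finType.
Implicit Types (G X S : {set T}) (F : {set T * T}).

Definition reach F : rel T := connect (fun u v => (u, v) \in F).

Definition up G F (v : T) : {set T} := [set u in G | reach F u v].

Definition down G F X : {set T} := [set u in G | [exists v in X, reach F v u]].

(* For a transitive digraph, acyclic means loopless. *)
Definition transitive_acyclic G F : Prop :=
  [/\ F \subset setX G G,
      forall u, (u, u) \notin F &
      forall u v w, (u, v) \in F -> (v, w) \in F -> (u, w) \in F].

Definition transitive_closure F : {set T * T} :=
  [set e | (e.1 != e.2) && reach F e.1 e.2].

Definition component G F (u : T) : {set T} :=
  [set w in G | reach F u w && reach F w u].

End Digraphs.

Section RingFamily.
Variables (R : realType) (T : finType).
Variables (G : {set T}) (F : {set T * T}) (f : {set T} -> R).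

Definition ell : {ffun T -> R} :=
  [ffun v => f ((G :\: up G F v) :|: [set v]) - f (G :\: up G F v)].

Definition fdown (X : {set T}) : R :=
  f (down G F X) - neg_sum ell (down G F X :\: X).

End RingFamily.

(* Computations that return a value together with their running time.  Each
   operation or comparison of real numbers takes time 1; operations on sets,
   orderings and digraphs, which involve no number, are not counted. *)

Definition timed (A : Type) := (A * nat)%type.

Definition ret {A} (a : A) : timed A := (a, 0%N).

Definition bind {A B} (m : timed A) (k : A -> timed B) : timed B :=
  let r := k m.1 in (r.1, (m.2 + r.2)%N).

Notation "'let*' x ':=' m 'in' k" := (bind m (fun x => k))
  (at level 200, x name, m at level 100, k at level 200).

Section TimedPrimitives.
Variable R : realType.
Implicit Types x y : R.

Definition addt x y : timed R := (x + y, 1%N).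
Definition subt x y : timed R := (x - y, 1%N).
Definition oppt x : timed R := (- x, 1%N).
Definition mult x y : timed R := (x * y, 1%N).
Definition mint x y : timed R := (Num.min x y, 1%N).
Definition ltt x y : timed bool := (x < y, 1%N).

End TimedPrimitives.

Definition foldt {A S} (step : S -> A -> timed S) : S -> seq A -> timed S :=
  fix loop st s :=
    if s is a :: s' then let* st' := step st a in loop st' s' else ret st.

Definition mapt {A B} (g : A -> timed B) : seq A -> timed (seq B) :=
  fix loop s :=
    if s is a :: s' then
      let* b := g a in let* bs := loop s' in ret (b :: bs)
    else ret [::].

Definition sumt {A} {R : realType} (g : A -> timed R) (s : seq A) : timed R :=
  foldt (fun acc a => let* r := g a in addt acc r) 0 s.

(* The vector with coordinates g v for v in G, all of them computed once. *)
Definition tabulate {R : realType} {T : finType} (G : {set T})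
    (g : T -> timed R) : timed {ffun T -> R} :=
  ([ffun v => if v \in G then (g v).1 else 0], (\sum_(v in G) (g v).2)%N).

Definition filtert {T : finType} (U : {set T}) (p : T -> timed bool) :
    timed {set T} :=
  ([set v in U | (p v).1], (\sum_(v in U) (p v).2)%N).

Definition neg_sumt {R : realType} {T : finType} (x : {ffun T -> R})
    (U : {set T}) : timed R :=
  sumt (fun v => mint 0 (x v)) (enum U).

Definition extreme_baset {R : realType} {T : finType} (G : {set T})
    (h : {set T} -> timed R) (s : seq T) : timed {ffun T -> R} :=
  tabulate G (fun v =>
    let* a := h (upto s v) in let* b := h (before s v) in subt a b).

Definition ellt {R : realType} {T : finType} (G : {set T}) (F : {set T * T})
    (f : {set T} -> timed R) : timed {ffun T -> R} :=
  tabulate G (fun v =>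
    let* a := f ((G :\: up G F v) :|: [set v]) in
    let* b := f (G :\: up G F v) in subt a b).

(* Evaluation of fdown at X, given the table l of the values of ell. *)
Definition fdownt {R : realType} {T : finType} (G : {set T}) (F : {set T * T})
    (f : {set T} -> timed R) (l : {ffun T -> R}) (X : {set T}) : timed R :=
  let* a := f (down G F X) in
  let* b := neg_sumt l (down G F X :\: X) in subt a b.

(* The oracle.  The convex combination is a list of pairs of a weight and an
   ordering of the ground set, which stands for the extreme base it defines.  The
   empty ground set is excluded from the specification because a convex
   combination has a term, whereas the bound c * #|G| would be 0. *)

Record sfm_output (R : realType) (T : finType) := SfmOutput {
  sfm_set : {set T};
  sfm_base : {ffun T -> R};
  sfm_comb : seq (R * seq T) }.

Definition sfm_oracle (R : realType) :=
  forall T : finType, {set T} -> ({set T} -> R) -> R -> timed (sfm_output R T).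

Definition is_approx_sfm (R : realType) (c : nat) (O : sfm_oracle R) : Prop :=
  forall (T : finType) (G : {set T}) (h : {set T} -> R) (delta : R),
    G != set0 -> submodular G h -> h set0 = 0 -> 0 < delta ->
    let out := (O T G h delta).1 in
    let W := sfm_set out in
    let y := sfm_base out in
    let comb := sfm_comb out in
    W \subset G /\
    base_polytope G h y /\
    (size comb <= c * #|G|)%N /\
    (forall p, p \in comb -> 0 <= p.1 /\ perm_eq p.2 (enum G)) /\
    \sum_(p <- comb) p.1 = 1 /\
    (forall v, v \in G -> y v = \sum_(p <- comb) p.1 * extreme_base h p.2 v) /\
    h W <= neg_sum y G + delta * max_norm G h.

Section Algorithm.
Variables (R : realType) (O : sfm_oracle R) (EO : nat) (V : finType).

(* A node of the current ground set is the set of the original elements that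
   have been contracted to it.  The current function is kept as an evaluation
   procedure, so that an evaluation of a contracted function also pays for the
   arithmetic of the earlier contractions. *)
Notation node := {set V}.

Record state := State {
  ground : {set node};
  fn : {set node} -> timed R;
  arcs : {set node * node};
  removed : {set node} }.

Definition fval (st : state) (S : {set node}) : R := (fn st S).1.

Definition init (f : {set V} -> R) : state :=
  State [set [set v] | v : V] (fun S => (f (cover S), EO)) set0 set0.

(* F is the current set of arcs, while hdown evaluates the function to which y
   and comb refer. *)
Definition add_arcs (G : {set node}) (f hdown : {set node} -> timed R)
    (y : {ffun node -> R}) (comb : seq (R * seq node))
    (F : {set node * node}) (z : node) : timed {set node * node} :=
  let U := G :\: up G F z in
  let* a := f U in
  let* s := neg_sumt y U in
  let* m := mult #|G|%:R s in
  let* b := oppt m in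
  let* test := ltt b a in
  if test then
    let* comb' := mapt (fun p : R * seq node =>
        let* g := extreme_baset G hdown (push p.2 (up G F z)) in ret (p.1, g))
      comb in
    let* y' := tabulate G (fun v =>
        sumt (fun p : R * {ffun node -> R} => mult p.1 (p.2 v)) comb') in
    let* s' := neg_sumt y' U in
    let* b' := oppt s' in
    let* A := filtert U (fun v => ltt b' (y' v)) in
    ret (F :|: [set (v, z) | v in A])
  else ret F.

Definition remove_down (st : state) (v : node) : timed state :=
  let f := fn st in
  let A := down (ground st) (arcs st) [set v] in
  let G' := ground st :\: A in
  let* a := f A in
  let* b := f (G' :|: A) in
  let* d := subt b a in
  let* top := mint 0 d in
  ret (State G'
    (fun S => if S == G' then ret top else let* x := f (S :|: A) in subt x a)
    (arcs st :&: setX G' G')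
    (removed st :|: A)).

(* A node v that has left the ground set with an earlier node is skipped. *)
Definition remove_if (y : {ffun node -> R}) (theta : R) (st : state) (v : node) :
    timed state :=
  if v \in ground st then
    let* test := ltt (y v) theta in
    if test then remove_down st v else ret st
  else ret st.

Definition merge_components (st : state) : state :=
  let G := ground st in
  let merge u := cover (component G (arcs st) u) in
  State [set merge u | u in G]
    (fun S => fn st [set u in G | merge u \in S])
    (transitive_closure [set (merge e.1, merge e.2) | e in arcs st])
    (removed st).

(* One test of the loop condition, followed by one pass through the loop body if
   it holds; None means that the loop has ended.  ell and fdown belong to the
   digraph at the start of the pass, since the oracle returns bases of that fdown;
   the sets up and down used to add arcs and to remove nodes are those of the
   digraph at the time of their evaluation. *)
Definition iteration (delta : R) (st : state) : timed (option state) :=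
  let G := ground st in
  let f := fn st in
  let F := arcs st in
  let* l := ellt G F f in
  let* lneg := neg_sumt l G in
  let* continue := ltt lneg 0 in
  if continue then
    let* out := O G (fdown G F (fval st)) delta in
    let y := sfm_base out in
    let* F' := foldt (add_arcs G f (fdownt G F f l) y (sfm_comb out))
      F (enum G) in
    let* t := mult 2 lneg in
    let* theta := mult t delta in
    let* st' := foldt (remove_if y theta) (State G f F' (removed st)) (enum G) in
    ret (Some (merge_components st'))
  else ret None.

(* The loop started in a state ends, returns S and takes time t. *)
Inductive runs (delta : R) : state -> {set V} -> nat -> Prop :=
| runs_stop st t :
    iteration delta st = (None, t) -> runs delta st (cover (removed st)) t
| runs_step st st' t S t' :
    iteration delta st = (Some st', t) -> runs delta st' S t' ->
    runs delta st S (t + t')%N.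

Inductive reached (f : {set V} -> R) (delta : R) : state -> Prop :=
| reached_init : reached f delta (init f)
| reached_step st st' :
    reached f delta st -> (iteration delta st).1 = Some st' ->
    reached f delta st'.

(* The maximum of AO over the original function and the contracted functions
   that arise in the algorithm, each with all ring families on its ground set. *)
Definition AOdown (f : {set V} -> R) (delta : R) : \bar R :=
  ereal_sup (fun a : \bar R => exists (st : state) (F : {set node * node}),
    [/\ reached f delta st, transitive_acyclic (ground st) F &
        a = ((O (ground st) (fdown (ground st) F (fval st)) delta).2)%:R%:E]).

End Algorithm.

(* Main.v *)
Require Import Defs.
From mathcomp Require Import all_boot all_order all_algebra.
From mathcomp Require Import constructive_ereal reals ereal.
From mathcomp Require Import zify ring lra.
Import Order.TTheory GRing.Theory Num.Theory.
Local Open Scope ring_scope.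
Set Implicit Arguments.
Unset Strict Implicit.
Unset Printing Implicit Defensive.

(** Let M be the least minimizer of f, that is, the minimizer contained in all
    others; it exists because the minimizers of a submodular function are closed
    under intersection, and it is the unique inclusionwise minimal one.  The proof
    follows M through the run.  At every moment M is the union of the removed nodes
    and of the least minimizer X of the current function, and X is stable, i.e. no
    arc leaves it (loop_invariant).

    An arc (v, z) is only added when X, if it contained v but not z, would have a
    positive value (arc_valid), so X stays stable.  Since fdown is submodular
    (fdown_submodular) and its bases have norm at most -2 ell^-(G), where G is the
    current ground set (norm_base_le), a coordinate of y below 2 ell^-(G) delta
    belongs to every stable minimizer (small_coordinate_in_minimizer), so that only
    elements of X are removed; X being stable, the closure of a removed node is
    removed from X as well (remove_down_spec).  The components of the digraph are
    either inside X or disjoint from it, so contracting them is harmless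
    (merge_loop_invariant).  When ell^-(G) = 0, f is nonnegative on stable sets,
    hence X is empty and M is the union of the removed nodes
    (least_minimizer_stop).

    For the running time, the potential of a state is the number of ordered pairs of
    nodes such that the first does not reach the second, plus the number of nodes;
    it is O(n^2) at the start and never increases.  The value of delta guarantees
    that a pass which removes no node finds an element z passing the test
    (test_passes), and each such z gives rise to a new arc (arc_exists).  Hence
    every pass decreases the potential and there are O(n^2) of them, each costing
    one call of the oracle and O(n) evaluations.  The expensive part, pushing the
    O(n) bases with O(n^2) evaluations, happens only when the test passes and is
    charged to the decrease of the potential that the new arc brings, so that in
    total it takes O(n^4) evaluations.  An evaluation costs EO + n because it may
    pass through n removals (inv_time). *)

(** * Extreme bases and the greedy algorithm *)

Section Greedy.
Variables (R : realType) (T : finType).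
Implicit Types (G S U X Y : {set T}) (h : {set T} -> R) (s : seq T).

Lemma upto_before s v : v \in s -> upto s v = v |: before s v.
Proof.
move=> vs; apply/setP=> u; rewrite !inE (take_nth v) ?index_mem //.
by rewrite mem_rcons inE nth_index.
Qed.

Lemma notin_before s v : v \notin before s v.
Proof. by rewrite inE; apply/negP=> /index_ltn; rewrite ltnn. Qed.

Lemma submodular_gain G h X Y v :
  submodular G h -> X \subset Y -> Y \subset G -> v \in G -> v \notin Y ->
  h (v |: Y) - h Y <= h (v |: X) - h X.
Proof.
move=> sub XY YG vG vY.
have XG := subset_trans XY YG.
have vXG : v |: X \subset G by rewrite subUset sub1set vG XG.
have := sub (v |: X) Y vXG YG.
have -> : (v |: X) :&: Y = X.
  apply/setP=> u; rewrite !inE; case: (u =P v) => [->|_] /=.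
    by rewrite (negPf vY); apply/esym/negP=> /(subsetP XY); rewrite (negPf vY).
  by apply/andP/idP=> [[]//|uX]; split=> //; apply: (subsetP XY).
have -> : (v |: X) :|: Y = v |: Y.
  by rewrite -setUA (setUidPr XY).
lra.
Qed.

Lemma extreme_base_cat h s1 s2 v :
  v \in s1 -> extreme_base h (s1 ++ s2) v = extreme_base h s1 v.
Proof.
move=> vs; rewrite !ffunE /upto /before index_cat vs !takel_cat ?index_size //.
by rewrite index_mem.
Qed.

Lemma extreme_base_rcons h s v : v \notin s ->
  extreme_base h (rcons s v) v = h (v |: [set u in s]) - h [set u in s].
Proof.
move=> vs; rewrite ffunE upto_before; last by rewrite mem_rcons inE eqxx.
rewrite /before -cats1 index_cat (negPf vs) /= eqxx addn0.
by rewrite take_size_cat.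
Qed.

(** The greedy inequality: when the last element of the ordering lies in S, its
    gain over the whole prefix is at most its gain over the part of the prefix in
    S. *)
Lemma greedy_le G h s S :
  submodular G h -> h set0 = 0 -> uniq s -> {subset s <= G} ->
  \sum_(v <- s | v \in S) extreme_base h s v <= h [set v in s | v \in S].
Proof.
move=> sub h0; elim/last_ind: s => [|s a IH].
  have -> : [set v in [::] | v \in S] = set0 by apply/setP=> u; rewrite !inE.
  by rewrite big_nil h0.
rewrite rcons_uniq => /andP[as_ us] sG.
have sG' : {subset s <= G} by move=> u us'; apply: sG; rewrite mem_rcons inE us' orbT.
have aG : a \in G by apply: sG; rewrite mem_rcons inE eqxx.
have E : \sum_(v <- s | v \in S) extreme_base h (rcons s a) v =
         \sum_(v <- s | v \in S) extreme_base h s v.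
  rewrite big_seq_cond [RHS]big_seq_cond; apply: eq_bigr => v /andP[vs _].
  by rewrite -cats1 extreme_base_cat.
rewrite big_rcons /= E; have := IH us sG'.
case: ifP => aS IHs; last first.
  rewrite addr0 (_ : [set _ in rcons s a | _] = [set v in s | v \in S]) //.
  apply/setP=> u; rewrite !inE mem_rcons inE.
  by case: (u =P a) => [->|]//=; rewrite aS andbF.
rewrite extreme_base_rcons //.
have -> : [set v in rcons s a | v \in S] = a |: [set v in s | v \in S].
  apply/setP=> u; rewrite !inE mem_rcons inE.
  by case: (u =P a) => [->|]//=; rewrite aS.
have := @submodular_gain G h [set v in s | v \in S] [set u in s] a sub.
have XY : [set v in s | v \in S] \subset [set u in s].
  by apply/subsetP=> u; rewrite !inE => /andP[].
have YG : [set u in s] \subset G by apply/subsetP=> u; rewrite inE; apply: sG'.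
move=> /(_ XY YG aG); rewrite inE => /(_ as_); lra.
Qed.

Lemma greedy_prefix h s1 s2 : uniq (s1 ++ s2) ->
  \sum_(v <- s1) extreme_base h (s1 ++ s2) v = h [set v in s1] - h set0.
Proof.
elim/last_ind: s1 s2 => [|s a IH] s2.
  have -> : [set v in [::]] = set0 :> {set T} by apply/setP=> u; rewrite !inE.
  by rewrite big_nil subrr.
move=> us; rewrite big_rcons /= cat_rcons IH -?cat_rcons //.
have aNs : a \notin s.
  by move: us; rewrite cat_uniq rcons_uniq => /andP[/andP[]].
rewrite extreme_base_cat ?mem_rcons ?inE ?eqxx // extreme_base_rcons //.
rewrite (_ : [set v in rcons s a] = a |: [set u in s]); first by lra.
by apply/setP=> u; rewrite !inE mem_rcons inE.
Qed.

Lemma extreme_base_in_base G h s :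
  submodular G h -> h set0 = 0 -> perm_eq s (enum G) ->
  base_polytope G h (extreme_base h s).
Proof.
move=> sub h0 pe.
have us : uniq s by rewrite (perm_uniq pe) enum_uniq.
have ms u : (u \in s) = (u \in G) by rewrite (perm_mem pe) mem_enum.
split=> [S SG|].
  have := @greedy_le G h s S sub h0 us.
  have sG : {subset s <= G} by move=> u; rewrite ms.
  move=> /(_ sG); rewrite (_ : [set v in s | v \in S] = S).
    rewrite (perm_big _ pe) /= big_enum_cond /=.
    rewrite (eq_bigl (mem S)) // => u /=.
    by apply/andP/idP=> [[]//|uS]; split=> //; apply: (subsetP SG).
  apply/setP=> u; rewrite inE ms andbC.
  by apply/andP/idP=> [[]//|uS]; split=> //; apply: (subsetP SG).
have := @greedy_prefix h s [::]; rewrite cats0 h0 subr0 => /(_ us).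
rewrite (perm_big _ pe) /= big_enum /= => ->; congr h.
by apply/setP=> u; rewrite inE ms.
Qed.

Lemma take_index_filter (p : pred T) s v : p v ->
  take (index v (seq.filter p s)) (seq.filter p s) =
  seq.filter p (take (index v s) s).
Proof.
move=> pv; elim: s => [|a s IH] //=.
have [->|av] := eqVneq a v; first by rewrite pv /= eqxx.
by case: ifP => pa /=; rewrite ?(negPf av) /= ?pa -IH.
Qed.

Lemma perm_push s S : perm_eq (push s S) s.
Proof. by rewrite /push perm_catC; apply/permPl/(perm_filterC (mem S)). Qed.

Lemma before_push s S v : v \in s -> v \notin S ->
  before (push s S) v = before s v :\: S.
Proof.
move=> vs vS; apply/setP=> u; rewrite !inE /push index_cat mem_filter vs vS /=.
by rewrite takel_cat ?index_size // take_index_filter // mem_filter.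
Qed.

(** Pushing S to the end only removes predecessors of an element outside S, and
    gains decrease with the set of predecessors. *)
Lemma push_mono G h s S v :
  submodular G h -> perm_eq s (enum G) -> v \in G -> v \notin S ->
  extreme_base h s v <= extreme_base h (push s S) v.
Proof.
move=> sub pe vG vS.
have ms u : (u \in s) = (u \in G) by rewrite (perm_mem pe) mem_enum.
rewrite !ffunE !upto_before ?(perm_mem (perm_push s S)) ?ms //.
rewrite before_push ?ms //; apply: (@submodular_gain G) => //.
- exact: subsetDl.
- by apply/subsetP=> u; rewrite inE => /mem_take; rewrite ms.
- exact: notin_before.
Qed.

Lemma push_sum G h s S :
  h set0 = 0 -> perm_eq s (enum G) ->
  \sum_(v in G :\: S) extreme_base h (push s S) v = h (G :\: S).
Proof.
move=> h0 pe.
have us : uniq s by rewrite (perm_uniq pe) enum_uniq.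
have ms u : (u \in s) = (u \in G) by rewrite (perm_mem pe) mem_enum.
have := @greedy_prefix h [seq v <- s | v \notin S] [seq v <- s | v \in S].
rewrite -/(push s S) (perm_uniq (perm_push s S)) => /(_ us).
rewrite h0 subr0 big_filter big_seq_cond (perm_big _ pe) /= big_enum_cond /=.
rewrite (_ : [set v in _] = G :\: S); last first.
  by apply/setP=> u; rewrite !inE mem_filter ms.
move=> <-; apply: eq_bigl => u; rewrite !inE ms.
by case: (u \in G); rewrite ?andbF ?andbT.
Qed.

End Greedy.

(** * Digraphs and the function fdown *)

Section Reachability.
Variable T : finType.
Implicit Types (G X Y A : {set T}) (F : {set T * T}).

Definition stable F X := forall u v, (u, v) \in F -> u \in X -> v \in X.

Lemma reach_stable F X u v : stable F X -> reach F u v -> u \in X -> v \in X.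
Proof.
move=> st /connectP[p pP ->]; elim: p u pP => //= w p IH u /andP[uw pP] uX.
by apply: IH => //; apply: st uw uX.
Qed.

Lemma reach_sub F F' u v : F \subset F' -> reach F u v -> reach F' u v.
Proof.
move=> FF'; apply: connect_sub => a b ab; apply: connect1.
exact: (subsetP FF').
Qed.

Lemma stable_sub F F' X : F \subset F' -> stable F' X -> stable F X.
Proof. by move=> FF' st u v /(subsetP FF'); apply: st. Qed.

Lemma down_stable G F X : F \subset setX G G -> stable F (down G F X).
Proof.
move=> FG u v uv; have := subsetP FG _ uv; rewrite !inE /= => /andP[_ vG].
case/andP=> _ /existsP[w /andP[wX wu]]; rewrite vG /=; apply/existsP; exists w.
by rewrite wX; apply: connect_trans wu (connect1 _).
Qed.

Lemma down_sub G F X : down G F X \subset G.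
Proof. by apply/subsetP=> u; rewrite inE => /andP[]. Qed.

Lemma sub_down G F X : X \subset G -> X \subset down G F X.
Proof.
move=> XG; apply/subsetP=> u uX; rewrite inE (subsetP XG) //=.
by apply/existsP; exists u; rewrite uX; apply: connect0.
Qed.

Lemma down_min G F X Y : X \subset Y -> stable F Y -> down G F X \subset Y.
Proof.
move=> XY st; apply/subsetP=> u; rewrite inE => /andP[_ /existsP[v /andP[vX vu]]].
by apply: (reach_stable st vu); apply: (subsetP XY).
Qed.

Lemma down_id G F X : X \subset G -> stable F X -> down G F X = X.
Proof. by move=> XG st; apply/eqP; rewrite eqEsubset sub_down // down_min. Qed.

Lemma downU G F X Y : down G F (X :|: Y) = down G F X :|: down G F Y.
Proof.
apply/setP=> u; rewrite !inE -andb_orr; congr (_ && _).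
apply/existsP/orP=> [[w /andP[]]|[] /existsP[w /andP[wX wu]]].
- by rewrite inE => /orP[] wX wu; [left|right]; apply/existsP; exists w; rewrite wX.
- by exists w; rewrite inE wX.
- by exists w; rewrite inE wX orbT.
Qed.

Lemma stableI F X Y : stable F X -> stable F Y -> stable F (X :&: Y).
Proof.
by move=> sX sY u v uv; rewrite !inE => /andP[uX uY]; rewrite (sX u v) ?(sY u v).
Qed.

Lemma compl_up_stable G F z :
  F \subset setX G G -> stable F (G :\: up G F z).
Proof.
move=> FG u v uv; have := subsetP FG _ uv; rewrite !inE /= => /andP[uG vG].
rewrite uG vG !andbT /=; apply: contra => vz.
by apply: connect_trans (connect1 _) vz.
Qed.

Lemma stable_compl_up G F X z :
  stable F X -> X \subset G -> z \notin X -> X \subset G :\: up G F z.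
Proof.
move=> st XG zX; apply/subsetP=> u uX; rewrite !inE (subsetP XG) // andbT /=.
by apply: contra zX => uz; apply: (reach_stable st uz).
Qed.

(** A path that ends outside a stable set never enters it. *)
Lemma reach_restrict G F A a b :
  F \subset setX G G -> stable F A -> a \in G :\: A -> b \in G :\: A ->
  reach F a b -> reach (F :&: setX (G :\: A) (G :\: A)) a b.
Proof.
move=> FG st aG bG /connectP[p pP be]; elim: p a aG pP be => [|w p IH] a aG /=.
  by move=> _ ->; apply: connect0.
case/andP=> aw pP be.
have wb : reach F w b by apply/connectP; exists p.
have wG : w \in G :\: A.
  have := subsetP FG _ aw; rewrite !inE /= => /andP[_ ->]; rewrite andbT.
  apply: contraL bG => wA; rewrite !inE negb_and negbK.
  by rewrite (reach_stable st wb wA).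
apply: connect_trans (IH _ wG pP be); apply: connect1.
by rewrite inE aw inE aG.
Qed.

Lemma reach_antisym G F u v :
  transitive_acyclic G F -> reach F u v -> reach F v u -> u = v.
Proof.
case=> _ irr tr; have rE a b : reach F a b -> a = b \/ (a, b) \in F.
  case/connectP=> p; elim: p a => [|w p IH] a /=; first by move=> _ ->; left.
  case/andP=> aw /IH{}IH /IH[<-|wb]; first by right.
  by right; apply: tr wb.
move=> /rE[//|uv] /rE[//|vu]; by have := irr u; rewrite (tr u v u).
Qed.

Lemma up_refl G F v : v \in G -> v \in up G F v.
Proof. by move=> vG; rewrite inE vG; apply: connect0. Qed.

End Reachability.

Section Fdown.
Variables (R : realType) (T : finType) (G : {set T}) (F : {set T * T}).
Variable f : {set T} -> R.
Hypotheses (acF : transitive_acyclic G F) (subf : submodular G f).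
Implicit Types (X Y Z D : {set T}) (z : {ffun T -> R}).

Local Notation l := (ell G F f).
Local Notation fd := (fdown G F f).

Let FG : F \subset setX G G. Proof. by case: acF. Qed.

Lemma neg_sumD z X Y : Y \subset X -> neg_sum z (X :\: Y) = neg_sum z X - neg_sum z Y.
Proof.
move=> YX; rewrite /neg_sum [X in _ = X - _](big_setID Y) /= (setIidPr YX).
by rewrite addrAC subrr add0r.
Qed.

Lemma neg_sum_le0 z X : neg_sum z X <= 0.
Proof. by apply: sumr_le0 => v _; rewrite ge_min lexx. Qed.

Lemma neg_sumS z X Y : X \subset Y -> neg_sum z Y <= neg_sum z X.
Proof. by move=> XY; have := neg_sum_le0 z (Y :\: X); rewrite neg_sumD //; lra. Qed.

Lemma neg_sum_le_sum z X : neg_sum z X <= \sum_(v in X) z v.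
Proof. by apply: ler_sum => v _; rewrite ge_min lexx orbT. Qed.

Lemma ell_le_gain D v :
  D \subset G -> v \in D -> (forall u, u \in D -> reach F u v -> u = v) ->
  l v <= f D - f (D :\ v).
Proof.
move=> DG vD top; have vG := subsetP DG v vD.
rewrite ffunE.
have := subf DG (subsetDl G (up G F v)).
have -> : D :&: (G :\: up G F v) = D :\ v.
  apply/setP=> u; rewrite !inE; have [uD|] := boolP (u \in D); last by rewrite andbF.
  rewrite (subsetP DG) //= !andbT; congr negb; apply/idP/eqP=> [|->]; last exact: connect0.
  exact: top.
have -> : D :|: (G :\: up G F v) = (G :\: up G F v) :|: [set v].
  apply/setP=> u; rewrite !inE; have [->|uv] := eqVneq u v; first by rewrite vD orbT.
  rewrite orbF; have [uD|//] := boolP (u \in D).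
  rewrite (subsetP DG) //= andbT; apply/esym/negP=> ruv.
  by case/eqP: uv; apply: top.
lra.
Qed.

(** Adding the elements of D outside Z one at a time, each after the elements that
    it reaches, every intermediate set is stable and every gain is at least the
    corresponding value of ell. *)
Lemma neg_ell_le_gain Z D :
  stable F Z -> stable F D -> Z \subset D -> D \subset G ->
  neg_sum l (D :\: Z) <= f D - f Z.
Proof.
move=> sZ; move: {-1}#|D| (leqnn #|D|) => m.
elim: m D => [|m IH] D mD sD ZD DG.
  have D0 : D = set0 by apply/eqP; rewrite -cards_eq0; lia.
  have -> : Z = D by apply/eqP; rewrite eqEsubset ZD D0 sub0set.
  by rewrite setDv /neg_sum big_set0 subrr.
have [-> |DZ] := eqVneq D Z; first by rewrite setDv /neg_sum big_set0 subrr.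
have [v0 v0D] : exists v, v \in D :\: Z.
  by apply/set0Pn; rewrite setD_eq0; apply: contra DZ => DZ; rewrite eqEsubset DZ ZD.
case: (arg_maxnP (fun v => #|down G F [set v]|) v0D) => v vDZ vmax.
have [vZ vD] : v \notin Z /\ v \in D by case/setDP: vDZ.
have top u : u \in D -> reach F u v -> u = v.
  move=> uD uv; apply/eqP/negPn/negP=> nuv.
  have uZ : u \notin Z by apply: contra vZ; apply: reach_stable uv.
  have /vmax : u \in D :\: Z by rewrite inE uZ.
  apply/negP; rewrite -ltnNge; apply: proper_card; apply/properP; split.
    apply/subsetP=> w; rewrite !inE => /andP[-> /existsP[v' /andP[]]] /=.
    rewrite inE => /eqP-> vw; apply/existsP; exists u; rewrite inE eqxx.
    exact: connect_trans uv vw.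
  exists u; first by apply: (subsetP (sub_down F _)); rewrite ?inE ?sub1set ?(subsetP DG).
  rewrite inE (subsetP DG) //=; apply/negP=> /existsP[v' /andP[]].
  rewrite inE => /eqP-> vu; case/eqP: nuv; exact: reach_antisym acF uv vu.
have sDv : stable F (D :\ v).
  move=> a b ab; rewrite !inE => /andP[av aD]; rewrite (sD a b) // andbT.
  apply: contra av => /eqP bv; apply/eqP; apply: top => //.
  by rewrite -bv; apply: connect1.
have cD : (#|D :\ v| <= m)%N by move: mD; rewrite (cardsD1 v D) vD.
have ZDv : Z \subset D :\ v.
  apply/subsetP=> u uZ; rewrite !inE (subsetP ZD) // andbT.
  by apply: contra vZ => /eqP <-.
have := IH _ cD sDv ZDv (subset_trans (subsetDl _ _) DG).
have := ell_le_gain DG vD top.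
have lv : Num.min 0 (l v) <= l v by rewrite ge_min lexx orbT.
have lD : neg_sum l D = Num.min 0 (l v) + neg_sum l (D :\ v) by apply: big_setD1.
rewrite (neg_sumD _ ZD) (neg_sumD _ ZDv) lD; lra.
Qed.

(** On stable sets fdown is f, and in general it is the restriction of the
    function f - ell^- to stable sets, composed with down, plus a modular function.
    As f - ell^- is monotone on stable sets, replacing the intersection of two
    closures by the closure of the intersection does not increase it. *)
Lemma fdown_submodular : submodular G fd.
Proof.
move=> X Y XG YG; rewrite /fdown.
have XYG : X :&: Y \subset G by apply: subset_trans (subsetIl _ _) XG.
have XUG : X :|: Y \subset G by rewrite subUset XG.
rewrite !neg_sumD ?sub_down // downU.
set P := down G F X; set Q := down G F Y; set Z := down G F (X :&: Y).
have sP : stable F P by apply: down_stable.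
have sQ : stable F Q by apply: down_stable.
have sZ : stable F Z by apply: down_stable.
have PG : P \subset G by apply: down_sub.
have QG : Q \subset G by apply: down_sub.
have ZPQ : Z \subset P :&: Q.
  rewrite subsetI; apply/andP; split.
    exact: down_min (subset_trans (subsetIl X Y) (sub_down F XG)) sP.
  exact: down_min (subset_trans (subsetIr X Y) (sub_down F YG)) sQ.
have := neg_ell_le_gain sZ (stableI sP sQ) ZPQ (subset_trans (subsetIl _ _) PG).
have := subf PG QG; rewrite neg_sumD //.
have mod A B : neg_sum l (A :|: B) = neg_sum l A + neg_sum l B - neg_sum l (A :&: B).
  have -> : neg_sum l B = neg_sum l (B :\: A) + neg_sum l (A :&: B).
    by rewrite setIC /neg_sum [LHS](big_setID A) addrC.
  rewrite addrA addrK /neg_sum [LHS](big_setID A) /= setIUl setIid.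
  rewrite (setUidPl (subsetIr _ _)) setDUl setDv set0U; lra.
rewrite !mod; lra.
Qed.

Lemma fdown_stable X : stable F X -> X \subset G -> fd X = f X.
Proof.
by move=> sX XG; rewrite /fdown down_id // setDv /neg_sum big_set0 subr0.
Qed.

Lemma fdown_ground : fd G = f G.
Proof.
by apply: fdown_stable => // u v /(subsetP FG); rewrite inE => /andP[].
Qed.

Lemma fdown0 : f set0 = 0 -> fd set0 = 0.
Proof. by move=> f0; rewrite fdown_stable ?sub0set // => u v _; rewrite inE. Qed.

(** If v lies in the closure of the other elements then fdown (G :\ v) exceeds
    f G by exactly -ell^-(v); otherwise v is the only element that reaches v and its gain
    is ell(v). *)
Lemma neg_ell_le_base z v :
  base_polytope G fd z -> v \in G -> Num.min 0 (l v) <= z v.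
Proof.
case=> zle zG vG.
have := zle (G :\ v) (subsetDl _ _); move: zG.
rewrite fdown_ground (big_setD1 v) //= => zG zv.
suff : Num.min 0 (l v) <= f G - fd (G :\ v) by lra.
have GvG : G :\ v \subset G := subsetDl _ _.
have [vd|vd] := boolP (v \in down G F (G :\ v)).
  have dG : down G F (G :\ v) = G.
    apply/eqP; rewrite eqEsubset down_sub /= -{1}(setD1K vG) subUset sub1set vd.
    exact: sub_down.
  have lG : neg_sum l G = Num.min 0 (l v) + neg_sum l (G :\ v) by apply: big_setD1.
  by rewrite /fdown dG (neg_sumD _ GvG) lG addrK subKr.
have dG : down G F (G :\ v) = G :\ v.
  apply/eqP; rewrite eqEsubset sub_down // andbT; apply/subsetP=> u ud.
  rewrite !inE (subsetP (down_sub G F _) _ ud) andbT.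
  by apply: contraNneq vd => uv; rewrite -{1}uv.
have -> : fd (G :\ v) = f (G :\ v).
  by rewrite /fdown dG setDv /neg_sum big_set0 subr0.
have top u : u \in G -> reach F u v -> u = v.
  move=> uG uv; apply/eqP; apply: contraNT vd => nuv.
  by rewrite inE vG; apply/existsP; exists u; rewrite !inE nuv uG.
have := ell_le_gain (subxx G) vG top.
have lv : Num.min 0 (l v) <= l v by rewrite ge_min lexx orbT.
lra.
Qed.

Lemma norm_base_le z : base_polytope G fd z -> f G <= 0 ->
  \sum_(v in G) `|z v| <= - 2 * neg_sum l G.
Proof.
move=> zB fG; have zE : \sum_(v in G) `|z v| = \sum_(v in G) z v - 2 * neg_sum z G.
  rewrite /neg_sum mulr_sumr -sumrB; apply: eq_bigr => v _.
  by case: (leP 0 (z v)) => zv; [rewrite ger0_norm|rewrite ltr0_norm]; lra.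
have zl : neg_sum l G <= neg_sum z G.
  apply: ler_sum => v vG; rewrite le_min ge_min lexx /=; exact: neg_ell_le_base.
rewrite zE; case: zB => _ ->; rewrite fdown_ground; lra.
Qed.

Lemma max_norm_fdown_le z : base_polytope G fd z -> f G <= 0 ->
  max_norm G fd <= - 2 * neg_sum l G.
Proof.
move=> zB fG; apply: ge_sup; first by exists (\sum_(v in G) `|z v|), z.
by move=> r [x xB ->]; apply: norm_base_le.
Qed.

End Fdown.

(** * What one pass learns about the least minimizer *)

Section Convex.
Variables (R : realType) (T : finType) (G : {set T}) (h : {set T} -> R).
Hypotheses (subh : submodular G h) (h0 : h set0 = 0).
Variable comb : seq (R * seq T).
Hypotheses (combP : forall p, p \in comb -> 0 <= p.1 /\ perm_eq p.2 (enum G))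
  (comb1 : \sum_(p <- comb) p.1 = 1).
Variable S : {set T}.

Variable y' : {ffun T -> R}.
Hypothesis y'E : forall v, v \in G ->
  y' v = \sum_(p <- comb) p.1 * extreme_base h (push p.2 S) v.

Let perm_push_enum p : p \in comb -> perm_eq (push p.2 S) (enum G).
Proof. by move=> /combP[_]; apply: perm_trans (perm_push _ _). Qed.

Lemma push_comb_sum (X : {set T}) : X \subset G -> \sum_(v in X) y' v =
  \sum_(p <- comb) p.1 * \sum_(v in X) extreme_base h (push p.2 S) v.
Proof.
move=> XG; under [RHS]eq_bigr do rewrite mulr_sumr.
by rewrite exchange_big; apply: eq_bigr => v vX; rewrite y'E ?(subsetP XG).
Qed.

Lemma push_comb_base : base_polytope G h y'.
Proof.
have eb p : p \in comb -> base_polytope G h (extreme_base h (push p.2 S)).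
  by move=> pc; apply: extreme_base_in_base => //; apply: perm_push_enum.
split=> [X XG|]; rewrite push_comb_sum // -[h _]mul1r -comb1 mulr_suml.
  rewrite big_seq [leRHS]big_seq; apply: ler_sum => p pc.
  by apply: ler_wpM2l; [case: (combP pc)|case: (eb p pc) => + _; apply].
rewrite big_seq [RHS]big_seq; apply: eq_bigr => p pc.
by case: (eb p pc) => _ ->.
Qed.

Lemma push_comb_mono (y : {ffun T -> R}) v :
  y v = \sum_(p <- comb) p.1 * extreme_base h p.2 v ->
  v \in G :\: S -> y v <= y' v.
Proof.
move=> yE /setDP[vG vS]; rewrite yE y'E // big_seq [leRHS]big_seq.
apply: ler_sum => p pc; have [p0 pe] := combP pc.
by apply: ler_wpM2l => //; apply: (push_mono subh).
Qed.

Lemma push_comb_tight : \sum_(v in G :\: S) y' v = h (G :\: S).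
Proof.
rewrite push_comb_sum ?subsetDl // -[h _]mul1r -comb1 mulr_suml.
rewrite big_seq [RHS]big_seq; apply: eq_bigr => p pc.
by rewrite push_sum //; case: (combP pc).
Qed.

End Convex.

Section LeastMinimizer.
Variables (R : realType) (T : finType).
Implicit Types (G U W X Y Z : {set T}) (F : {set T * T}) (f : {set T} -> R).
Implicit Types (y : {ffun T -> R}).

Definition least_minimizer G f X :=
  [/\ X \subset G, forall Y, Y \subset G -> f X <= f Y &
      forall Y, Y \subset G -> f Y <= f X -> X \subset Y].

(** The minimizers of a submodular function are closed under intersection. *)
Lemma ex_least_minimizer G f : submodular G f -> exists X, least_minimizer G f X.
Proof.
move=> sub.
have [X0 X0G X0min] : exists2 X : {set T}, X \subset G &
    forall Y : {set T}, Y \subset G -> f X <= f Y.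
  have := @arg_minP _ R _ set0 (fun X : {set T} => X \subset G) f (sub0set G).
  by case=> X XG Xmin; exists X.
pose P X := (X \subset G) && [forall (Y : {set T} | Y \subset G), f X <= f Y].
have P0 : P X0 by rewrite /P X0G; apply/forall_inP.
case: (arg_minnP (fun X : {set T} => #|X|) P0) => X /andP[XG /forall_inP Xmin] Xcard.
exists X; split=> // Y YG YX.
have XYG : X :&: Y \subset G by apply: subset_trans (subsetIl _ _) XG.
have XYmin : f (X :&: Y) <= f X.
  have := sub X Y XG YG.
  have : f X <= f (X :|: Y) by apply: Xmin; rewrite subUset XG.
  lra.
apply/setIidPl/eqP; rewrite eqEcard subsetIl Xcard // /P XYG /=.
by apply/forall_inP => Z ZG; apply: le_trans XYmin (Xmin _ ZG).
Qed.

Lemma least_minimizer_le0 G f X : f set0 = 0 -> least_minimizer G f X -> f X <= 0.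
Proof. by move=> f0 [_ /(_ set0 (sub0set _))]; rewrite f0. Qed.

(** A stable set X with f X <= 0 that avoids z lies in the complement U of the
    elements reaching z, so that the sum of y' over X is at most fdown X = f X <= 0;
    a coordinate exceeding the total negative part of y' over U cannot occur in
    such a sum. *)
Lemma arc_valid G F F' f X y' v z :
  F \subset F' -> base_polytope G (fdown G F f) y' ->
  stable F' X -> X \subset G -> f X <= 0 ->
  - neg_sum y' (G :\: up G F' z) < y' v -> v \in X -> z \in X.
Proof.
move=> FF' [yle _] sX XG fX yv vX; apply: contraT => zX.
have XU := stable_compl_up sX XG zX.
have := yle X XG; rewrite fdown_stable //; last exact: stable_sub FF' sX.
rewrite (big_setD1 v) //=.
have := neg_sum_le_sum y' (X :\ v).
have := neg_sumS y' (subset_trans (subsetDl X [set v]) XU).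
lra.
Qed.

(** By averaging: y' sums to h U over U, while pushing has not increased the
    negative part of y over U. *)
Lemma arc_exists G h U y y' :
  U \subset G -> (forall v, v \in U -> y v <= y' v) ->
  \sum_(v in U) y' v = h U :> R -> - (#|G|%:R * neg_sum y U) < h U ->
  exists2 v, v \in U & - neg_sum y' U < y' v.
Proof.
move=> UG yy' yU test; apply/exists_inP; apply: contraTT test.
rewrite negb_exists => /forallP none; rewrite -leNgt -yU.
have yle v : v \in U -> y' v <= - neg_sum y' U.
  by move=> vU; have := none v; rewrite vU /= -leNgt.
apply: le_trans (ler_sum _ yle) _; rewrite sumr_const -[leLHS]mulr_natl mulrN lerN2.
have ny : neg_sum y U <= neg_sum y' U.
  by apply: ler_sum => v vU; rewrite le_min ge_min lexx ge_min yy' ?orbT.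
have cU : #|U|%:R <= #|G|%:R :> R by rewrite ler_nat subset_leq_card.
have := neg_sum_le0 y' U => n0.
apply: (le_trans (y := #|G|%:R * neg_sum y' U)); first exact: ler_wpM2l.
by rewrite ler_wnM2r.
Qed.

(** A stable minimizer X of f satisfies fdown X <= fdown W <= y^-(G) + delta L, where
    L is the largest norm of a base, at most -2 ell^-(G).  The sum of y over X can be
    that small only if X contains every coordinate of y below 2 ell^-(G) delta. *)
Lemma small_coordinate_in_minimizer G F f delta W X y v :
  transitive_acyclic G F -> submodular G f -> f G <= 0 -> 0 < delta ->
  W \subset G -> base_polytope G (fdown G F f) y ->
  fdown G F f W <= neg_sum y G + delta * max_norm G (fdown G F f) ->
  stable F X -> X \subset G -> (forall Y, Y \subset G -> f X <= f Y) ->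
  v \in G -> y v < 2 * neg_sum (ell G F f) G * delta -> v \in X.
Proof.
move=> ac sub fG d0 WG yB Wopt sX XG Xmin vG yv; apply: contraT => vX.
have [FG _ _] := ac.
have fXW : f X <= fdown G F f W.
  have := Xmin _ (down_sub G F W); rewrite /fdown.
  have := neg_sum_le0 (ell G F f) (down G F W :\: W); lra.
have yX : \sum_(u in X) y u <= f X.
  by case: yB => + _; move=> /(_ X XG); rewrite fdown_stable.
have XGv : X \subset G :\ v.
  by apply/subsetP=> u uX; rewrite !inE (subsetP XG) // andbT; apply: contraNneq vX => <-.
have yG : neg_sum y G = Num.min 0 (y v) + neg_sum y (G :\ v) by apply: big_setD1.
have n1 := neg_sumS y XGv.
have n2 := neg_sum_le_sum y X.
have L : delta * max_norm G (fdown G F f) <= delta * (- 2 * neg_sum (ell G F f) G).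
  by rewrite ler_pM2l // (max_norm_fdown_le ac sub yB).
have yv0 : Num.min 0 (y v) <= y v by rewrite ge_min lexx orbT.
nra.
Qed.

(** With ell^- = 0 all gains along a chain of stable sets are nonnegative. *)
Lemma least_minimizer_stop G F f X :
  transitive_acyclic G F -> submodular G f -> f set0 = 0 ->
  least_minimizer G f X -> stable F X -> 0 <= neg_sum (ell G F f) G -> X = set0.
Proof.
move=> ac sub f0 [XG _ Xl] sX l0; apply/eqP; rewrite -subset0; apply: Xl (sub0set _) _.
have s0 : stable F set0 by move=> u v _; rewrite inE.
have := neg_ell_le_gain ac sub s0 sX (sub0set _) XG.
have := neg_sumS (ell G F f) (subset_trans (subsetDl X set0) XG); lra.
Qed.

(** Choose z with the smallest value of ell, let U be the complement of the set of
    elements reaching z, and N the size of G.  Then f(U) = f(U + z) - ell(z), where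
    -ell(z) >= |ell^-(G)| / N, while f(U + z) >= -2 N delta |ell^-(G)| because U + z
    is stable and y is bounded from below.  The test thus follows from
    2 N^2 delta + 2 N^2 (N - 1) delta = 2 N^3 delta < 1.  The factor N - 1 comes from
    z not being in U; with N in its place the constant 3 in delta would be too small
    for N = 1 and N = 2. *)
Lemma test_passes G F f y (n : nat) :
  let delta : R := 1 / (3 * n%:R ^+ 3) in
  let lneg := neg_sum (ell G F f) G in
  transitive_acyclic G F -> submodular G f -> (#|G| <= n)%N ->
  base_polytope G (fdown G F f) y -> lneg < 0 ->
  (forall v, v \in G -> 2 * lneg * delta <= y v) ->
  exists2 z, z \in G &
    - (#|G|%:R * neg_sum y (G :\: up G F z)) < f (G :\: up G F z).
Proof.
move=> delta lneg ac sub Gn yB l0 ybig.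
have [FG _ _] := ac.
set l := ell G F f.
have [v0 v0G] : exists v, v \in G.
  apply/set0Pn; apply: contraTneq l0 => G0.
  by rewrite /lneg G0 /neg_sum big_set0 ltxx.
have N0 : (0 < #|G|)%N by apply/card_gt0P; exists v0.
have n0 : (0 < n)%N by apply: leq_trans Gn.
case: (@arg_minP _ R _ v0 (mem G) l v0G) => z zG zmin.
exists z => //.
set U := G :\: up G F z; set N : R := #|G|%:R.
have N1 : 1 <= N by rewrite ler1n.
have d0 : 0 < delta by rewrite divr_gt0 // mulr_gt0 // exprn_gt0 // ltr0n.
have dN : 3 * (N ^+ 3 * delta) <= 1.
  have NnE : N ^+ 3 <= n%:R ^+ 3 by rewrite lerXn2r ?nnegrE ?ler0n // ler_nat.
  have nn : 0 < n%:R ^+ 3 :> R by rewrite exprn_gt0 // ltr0n.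
  have -> : 3 * (N ^+ 3 * delta) = N ^+ 3 / n%:R ^+ 3.
    by rewrite /delta; field; rewrite pnatr_eq0 -lt0n.
  by rewrite ler_pdivrMr // mul1r.
(* the minimum of ell is at most the average of ell^- *)
have lz : N * l z <= lneg.
  have lz0 : l z <= 0.
    rewrite leNgt; apply: contraTN l0 => lz0; rewrite -leNgt.
    apply: sumr_ge0 => v vG; rewrite le_min lexx /=.
    by apply: le_trans (ltW lz0) _; apply: zmin.
  rewrite mulr_natl -sumr_const; apply: ler_sum => v vG.
  by rewrite le_min lz0; apply: zmin.
have zU : z \notin U by rewrite inE up_refl.
have UG : U \subset G := subsetDl _ _.
have nbound X : X \subset G -> #|X|%:R * (2 * lneg * delta) <= neg_sum y X.
  move=> XG; rewrite mulr_natl -sumr_const; apply: ler_sum => v vX.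
  rewrite le_min ybig ?(subsetP XG) // andbT.
  have : 2 * lneg * delta < 0 by rewrite nmulr_rlt0 // pmulr_rlt0.
  exact: ltW.
have cU : (#|U| < #|G|)%N.
  by apply: proper_card; apply/properP; split=> //; exists z.
have cU' : #|U|%:R <= N - 1 :> R.
  by rewrite /N -(ltn_predK cU) -natr1 addrK ler_nat -ltnS (ltn_predK cU).
have sZ : stable F (U :|: [set z]).
  move=> a b ab; rewrite in_setU in_set1 => /orP[aU|/eqP az].
    by rewrite inE (compl_up_stable FG ab aU).
  have bG : b \in G by have := subsetP FG _ ab; rewrite inE => /andP[].
  rewrite !inE bG andbT; case: (b =P z) => [_|bz]; first by rewrite orbT.
  rewrite orbF /=; apply/negP=> rbz; apply: bz.
  by apply: reach_antisym ac rbz _; rewrite -az; apply: connect1.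
have ZG : U :|: [set z] \subset G by rewrite subUset UG sub1set.
have fZ : neg_sum y (U :|: [set z]) <= f (U :|: [set z]).
  apply: le_trans (neg_sum_le_sum _ _) _; case: yB => + _.
  by move=> /(_ _ ZG); rewrite fdown_stable.
have lzE : l z = f (U :|: [set z]) - f U by rewrite /l ffunE.
have b1 := nbound _ UG; have b2 := nbound _ ZG.
have cZ : #|U :|: [set z]|%:R <= N :> R by rewrite ler_nat subset_leq_card.
have m0 : 2 * lneg * delta < 0 by rewrite nmulr_rlt0 // pmulr_rlt0.
set m := 2 * lneg * delta in b1 b2 m0.
have c1 : (N - 1) * m <= neg_sum y U.
  by apply: le_trans b1; rewrite ler_wnM2r // ltW.
have c2 : N * m <= neg_sum y (U :|: [set z]).
  by apply: le_trans b2; rewrite ler_wnM2r // ltW.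
have N0' : 0 < N by lra.
rewrite -(ltr_pM2l N0').
have e1 : N * - (N * neg_sum y U) <= - (N ^+ 2 * ((N - 1) * m)).
  have -> : N * - (N * neg_sum y U) = - (N ^+ 2 * neg_sum y U) by ring.
  by rewrite lerN2 ler_pM2l // exprn_gt0.
have e2 : N * (N * m) - lneg <= N * f U.
  have -> : f U = f (U :|: [set z]) - l z by lra.
  by rewrite mulrBr lerB // ler_pM2l //; apply: le_trans c2 _.
have e3 : - (N ^+ 2 * ((N - 1) * m)) < N * (N * m) - lneg.
  have -> : - (N ^+ 2 * ((N - 1) * m)) = N * (N * m) - 2 * lneg * (N ^+ 3 * delta).
    by rewrite /m; ring.
  rewrite ltrD2l ltrN2; nra.
exact: le_lt_trans e1 (lt_le_trans e3 e2).
Qed.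

End LeastMinimizer.

(** * Values and running times of the timed primitives *)

Section Timed.
Variable R : realType.

Lemma sumtE A (g : A -> timed R) s :
  (sumt g s).1 = \sum_(a <- s) (g a).1 /\
  (sumt g s).2 = (\sum_(a <- s) ((g a).2 + 1))%N.
Proof.
rewrite /sumt; set step := fun acc : R => _.
suff H r : (foldt step r s).1 = r + \sum_(a <- s) (g a).1 /\
           (foldt step r s).2 = (\sum_(a <- s) ((g a).2 + 1))%N.
  by have [-> ->] := H 0; rewrite add0r.
elim: s r => [|a s IH] r /=; first by rewrite !big_nil addr0.
rewrite !big_cons /=; have [-> ->] := IH (r + (g a).1).
by rewrite addrA addn1.
Qed.

Lemma maptE A B (g : A -> timed B) s :
  (mapt g s).1 = [seq (g a).1 | a <- s] /\
  (mapt g s).2 = (\sum_(a <- s) (g a).2)%N.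
Proof.
elim: s => [|a s [IH1 IH2]] /=; first by rewrite big_nil.
by rewrite IH1 IH2 big_cons addn0.
Qed.

Variable T : finType.
Implicit Types (G U : {set T}) (F : {set T * T}) (f : {set T} -> timed R).

Lemma neg_sumtE (x : {ffun T -> R}) U :
  (neg_sumt x U).1 = neg_sum x U /\ (neg_sumt x U).2 = (2 * #|U|)%N.
Proof.
have [-> ->] := sumtE (fun v => mint 0 (x v)) (enum U).
by rewrite big_enum /= big_const_seq count_predT iter_addn addn0 -cardE mulnC.
Qed.

Lemma sum_le_card U (t : T -> nat) b :
  (forall v, t v <= b)%N -> (\sum_(v in U) t v <= #|U| * b)%N.
Proof. by move=> tb; rewrite -sum_nat_const; apply: leq_sum => v _. Qed.

Lemma ell_ellt G F f v : v \in G ->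
  (ellt G F f).1 v = ell G F (fun S => (f S).1) v.
Proof. by move=> vG; rewrite !ffunE vG. Qed.

Lemma neg_sum_ellt G F f U : U \subset G ->
  neg_sum (ellt G F f).1 U = neg_sum (ell G F (fun S => (f S).1)) U.
Proof. by move=> UG; apply: eq_bigr => v vU; rewrite ell_ellt ?(subsetP UG). Qed.

Lemma ellt_time G F f b : (forall S, (f S).2 <= b)%N ->
  ((ellt G F f).2 <= #|G| * (2 * b + 1))%N.
Proof.
move=> fb; apply: sum_le_card => v /=.
have := fb ((G :\: up G F v) :|: [set v]); have := fb (G :\: up G F v); lia.
Qed.

Lemma fdown_fdownt G F f S :
  (fdownt G F f (ellt G F f).1 S).1 = fdown G F (fun S => (f S).1) S.
Proof.
rewrite /fdownt /fdown /=; have [-> _] := neg_sumtE (ellt G F f).1 (down G F S :\: S).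
by rewrite neg_sum_ellt // (subset_trans (subsetDl _ _)) ?down_sub.
Qed.

Lemma fdownt_time G F f l S b : (forall S, (f S).2 <= b)%N ->
  ((fdownt G F f l S).2 <= b + 2 * #|G| + 1)%N.
Proof.
move=> fb; rewrite /fdownt /=; have [_ ->] := neg_sumtE l (down G F S :\: S).
have : (#|down G F S :\: S| <= #|G|)%N.
  by apply: subset_leq_card; rewrite (subset_trans (subsetDl _ _)) ?down_sub.
have := fb (down G F S); lia.
Qed.

Lemma extreme_baset_time G (h : {set T} -> timed R) s b :
  (forall S, (h S).2 <= b)%N -> ((extreme_baset G h s).2 <= #|G| * (2 * b + 1))%N.
Proof.
move=> hb; apply: sum_le_card => v /=.
have := hb (upto s v); have := hb (before s v); lia.
Qed.

End Timed.

(** * The potential of a state *)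

Section Potential.
Variable T : finType.
Implicit Types (G X A : {set T}) (F : {set T * T}).

(** Counting the nodes besides the unreached pairs makes the removal of a node a
    strict decrease, even if every pair that contains it is reached. *)
Definition unreached G F := #|[set e in setX G G | ~~ reach F e.1 e.2]|.

Definition potential G F := (unreached G F + #|G|)%N.

Lemma unreached_sub G F F' : F \subset F' -> (unreached G F' <= unreached G F)%N.
Proof.
move=> FF'; apply: subset_leq_card; apply/subsetP=> e; rewrite !inE => /andP[-> /=].
by apply: contra; apply: reach_sub.
Qed.

Lemma unreached_proper G F F' u v : F \subset F' -> u \in G -> v \in G ->
  (u, v) \in F' -> ~~ reach F u v -> (unreached G F' < unreached G F)%N.
Proof.
move=> FF' uG vG uv nuv; apply: proper_card; apply/properP; split.
  apply/subsetP=> e; rewrite !inE => /andP[-> /=].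
  by apply: contra; apply: reach_sub.
by exists (u, v); rewrite !inE uG vG //= ?nuv // negbK; apply: connect1.
Qed.

Lemma unreached_remove G F A : F \subset setX G G -> stable F A ->
  (unreached (G :\: A) (F :&: setX (G :\: A) (G :\: A)) <= unreached G F)%N.
Proof.
move=> FG sA; apply: subset_leq_card; apply/subsetP=> -[a b].
rewrite inE in_setX /= => /andP[/andP[aG bG] nab].
rewrite inE in_setX (subsetP (subsetDl G A) _ aG) (subsetP (subsetDl G A) _ bG) /=.
by apply: contra nab; apply: reach_restrict.
Qed.

Lemma potential_le G F : (potential G F <= 2 * #|G| ^ 2)%N.
Proof.
have : (unreached G F <= #|G| ^ 2)%N.
  rewrite -mulnn -cardsX; apply: subset_leq_card.
  by apply/subsetP=> e; rewrite inE => /andP[].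
rewrite /potential; case: #|G| => [|m]; nia.
Qed.

End Potential.

(** * Adding arcs *)

(** Bounds, for N nodes and evaluations taking time b, on the cost of testing one
    element z, and on the additional cost if the test passes.  The terms of the
    latter are for the pushed bases, for their convex combination y', for y'^- and
    the comparisons, and for one sign change. *)
Definition test_time (b N : nat) : nat := (b + 2 * N + 3)%N.

Definition push_time (c b N : nat) : nat :=
  (c * N * (N * (2 * (b + 2 * N + 1) + 1)) + N * (2 * (c * N)) + 3 * N + 1)%N.

Lemma leq_push_time c b N n : (N <= n)%N -> (push_time c b N <= push_time c b n)%N.
Proof.
by move=> Nn; rewrite /push_time; do ![apply: leq_add | apply: leq_mul | exact: leqnn | done].
Qed.

Section AddArcs.
Variables (R : realType) (V : finType).
Implicit Types (F : {set {set V} * {set V}}) (U : {set {set V}}) (z v : {set V}).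
Implicit Types (s : seq {set V}).
Notation node := {set V}.
Variables (G : {set node}) (F0 : {set node * node}) (f : {set node} -> timed R).
Variables (c b : nat) (y : {ffun node -> R}) (comb : seq (R * seq node)).
Let fv S := (f S).1.
Variable h : {set node} -> timed R.
Hypotheses (hE : forall S, (h S).1 = fdown G F0 fv S)
  (hb : forall S, ((h S).2 <= b + 2 * #|G| + 1)%N).
Hypotheses (acF0 : transitive_acyclic G F0) (subf : submodular G fv)
  (f0 : fv set0 = 0) (fb : forall S, ((f S).2 <= b)%N)
  (combc : (size comb <= c * #|G|)%N)
  (combP : forall p, p \in comb -> 0 <= p.1 /\ perm_eq p.2 (enum G))
  (comb1 : \sum_(p <- comb) p.1 = 1)
  (yE : forall v, v \in G ->
     y v = \sum_(p <- comb) p.1 * extreme_base (fdown G F0 fv) p.2 v).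
Variable X : {set node}.
Hypotheses (XG : X \subset G) (fX : fv X <= 0).

Definition arc_test (F : {set node * node}) (z : node) : bool :=
  - (#|G|%:R * neg_sum y (G :\: up G F z)) < fv (G :\: up G F z).

Local Notation test_time := (test_time b #|G|).
Local Notation push_time := (push_time c b #|G|).

(** Stated for arbitrary computations, so that unfolding bind does not duplicate
    large terms. *)
Lemma bind_test A (k : R) (ma ms : timed R) (T E : timed A) :
  (let* a := ma in let* s := ms in let* m := mult k s in let* b := oppt m in
   let* test := ltt b a in if test then T else E) =
  if - (k * ms.1) < ma.1 then (T.1, ma.2 + (ms.2 + (1 + (1 + (1 + T.2)))))%N
  else (E.1, ma.2 + (ms.2 + (1 + (1 + (1 + E.2)))))%N.
Proof. by rewrite /bind /=; case: ifP. Qed.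

Lemma bind_push A (mc : timed A) (my : A -> timed {ffun node -> R}) U F z :
  let y' := my mc.1 in
  let B := filtert U (fun v => ltt (- (neg_sumt y'.1 U).1) (y'.1 v)) in
  (let* c := mc in let* y' := my c in let* s' := neg_sumt y' U in
   let* b' := oppt s' in let* B := filtert U (fun v => ltt b' (y' v)) in
   ret (F :|: [set (v, z) | v in B])) =
  (F :|: [set (v, z) | v in B.1],
   mc.2 + (y'.2 + ((neg_sumt y'.1 U).2 + (1 + (B.2 + 0)))))%N.
Proof. by []. Qed.

Lemma pushed_coordinate F z v : v \in G ->
  let comb' := (mapt (fun p : R * seq node =>
        let* g := extreme_baset G h (push p.2 (up G F z)) in ret (p.1, g)) comb).1 in
  (tabulate G (fun v =>
     sumt (fun p : R * {ffun node -> R} => mult p.1 (p.2 v)) comb')).1 v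
  = \sum_(p <- comb) p.1 * extreme_base (fdown G F0 fv) (push p.2 (up G F z)) v.
Proof.
move=> vG; set m := mapt _ comb; rewrite /= ffunE vG.
have [-> _] := sumtE (fun p : R * {ffun node -> R} => mult p.1 (p.2 v)) m.1.
rewrite /m; have [-> _] := maptE (fun p : R * seq node =>
        let* g := extreme_baset G h (push p.2 (up G F z)) in ret (p.1, g)) comb.
rewrite big_map; apply: eq_bigr => p _ /=; rewrite !ffunE vG /=.
by rewrite !hE.
Qed.

(** The time bound is amortized: if the test passes then some arc (v, z) is added
    with v not reaching z, and the lost unreached pair pays for the push. *)
Lemma add_arcs_spec F z :
  F0 \subset F -> F \subset setX G G -> stable F X -> z \in G ->
  let r := add_arcs G f h y comb F z in
  [/\ F \subset r.1, r.1 \subset setX G G, stable r.1 X,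
      (if arc_test F z then is_true (unreached G r.1 < unreached G F)%N else r.1 = F) &
      (r.2 + unreached G r.1 * push_time <= test_time + unreached G F * push_time)%N].
Proof.
move=> F0F FG sX zG.
set U := G :\: up G F z; have UG : U \subset G := subsetDl _ _.
pose u := #|U|.
have [ns nt] : (neg_sumt y U).1 = neg_sum y U /\ (neg_sumt y U).2 = (2 * u)%N.
  exact: neg_sumtE.
have cU : (u <= #|G|)%N := subset_leq_card UG.
have test_le : ((f U).2 + (2 * u + 3) <= test_time)%N.
  by have := fb U; rewrite /test_time; lia.
pose comb' := mapt (fun p : R * seq node =>
        let* g := extreme_baset G h (push p.2 (up G F z)) in ret (p.1, g)) comb.
pose y' := tabulate G (fun v =>
        sumt (fun p : R * {ffun node -> R} => mult p.1 (p.2 v)) comb'.1).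
pose B := filtert U (fun v => ltt (- (neg_sumt y'.1 U).1) (y'.1 v)).
pose A := B.1.
rewrite /add_arcs -/U bind_test ns nt -/(arc_test F z) bind_push -/comb' -/y' -/B -/A.
case: ifP => test; last by split; [exact: subxx| | | |rewrite leq_add2r; exact: test_le].
have y'E v : v \in G -> y'.1 v =
    \sum_(p <- comb) p.1 * extreme_base (fdown G F0 fv) (push p.2 (up G F z)) v.
  by move=> vG; apply: pushed_coordinate.
have subh := fdown_submodular acF0 subf.
have h0 : fdown G F0 fv set0 = 0 by apply: fdown0.
have [ns' nt'] : (neg_sumt y'.1 U).1 = neg_sum y'.1 U /\
    (neg_sumt y'.1 U).2 = (2 * u)%N by exact: neg_sumtE.
have AE v : (v \in A) = (v \in U) && (- neg_sum y'.1 U < y'.1 v).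
  by rewrite /A inE ns'.
have FF' : F \subset F :|: [set (v, z) | v in A] := subsetUl _ _.
have F'G : F :|: [set (v, z) | v in A] \subset setX G G.
  rewrite subUset FG; apply/subsetP=> e /imsetP[v]; rewrite AE => /andP[vU _] ->.
  by rewrite inE /= zG (subsetP UG).
have [v vU vy] : exists2 v, v \in U & - neg_sum y'.1 U < y'.1 v.
  apply: (@arc_exists _ _ G (fdown G F0 fv) U y y'.1 UG).
  - by move=> w wU; apply: (push_comb_mono subh combP y'E (yE (subsetP UG w wU))).
  - exact: (push_comb_tight h0 combP comb1 y'E).
  - rewrite fdown_stable //; apply: stable_sub F0F _; exact: compl_up_stable.
have lt : (unreached G (F :|: [set (v, z) | v in A]) < unreached G F)%N.
  apply: (@unreached_proper _ G F _ v z) => //; first exact: (subsetP UG).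
    by rewrite inE; apply/orP; right; apply/imsetP; exists v; rewrite // AE vU.
  by move: vU; rewrite !inE negb_and => /andP[/orP[/negPf->|//]].
split; [exact: FF'|exact: F'G| |exact: lt|].
  move=> u' w; rewrite inE => /orP[|/imsetP[v']]; first exact: sX.
  rewrite AE => /andP[_ v'y] [-> ->] v'X.
  apply: (@arc_valid _ _ G F0 F fv X y'.1 v' z) => //.
  exact: (push_comb_base subh h0 combP comb1 y'E).
have ct : (comb'.2 <= c * #|G| * (#|G| * (2 * (b + 2 * #|G| + 1) + 1)))%N.
  rewrite /comb'; have [_ ->] := maptE (fun p : R * seq node =>
        let* g := extreme_baset G h (push p.2 (up G F z)) in ret (p.1, g)) comb.
  apply: leq_trans (_ : \sum_(p <- comb) (#|G| * (2 * (b + 2 * #|G| + 1) + 1)) <= _)%N.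
    apply: leq_sum => p _ /=; rewrite addn0; exact: extreme_baset_time.
  by rewrite big_const_seq count_predT iter_addn addn0 mulnC leq_mul2r combc orbT.
have yt : (y'.2 <= #|G| * (2 * (c * #|G|)))%N.
  apply: sum_le_card => w.
  have [_ ->] := sumtE (fun p : R * {ffun node -> R} => mult p.1 (p.2 w)) comb'.1.
  rewrite /comb'; have [-> _] := maptE (fun p : R * seq node =>
        let* g := extreme_baset G h (push p.2 (up G F z)) in ret (p.1, g)) comb.
  by rewrite big_map big_const_seq count_predT iter_addn addn0 leq_mul2l combc.
have At : B.2 = u.
  exact: sum1_card.
have pt : (comb'.2 + y'.2 + 2 * u + u + 1 <= push_time)%N.
  have sum_le m1 m2 a1 a2 m N : (m1 <= a1 -> m2 <= a2 -> m <= N ->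
      m1 + m2 + 2 * m + m + 1 <= a1 + a2 + 3 * N + 1)%N by clear; lia.
  exact: sum_le ct yt cU.
rewrite nt' At.
have sum_le a m b1 b2 q r' p : (a + (2 * m + 3) <= test_time ->
    b1 + b2 + 2 * m + m + 1 <= p -> r' < q ->
    a + (2 * m + (1 + (1 + (1 + (b1 + (b2 + (2 * m + (1 + (m + 0))))))))) + r' * p
      <= test_time + q * p)%N.
  by clear=> ? ? rq; have := leq_mul rq (leqnn p); rewrite mulSn; lia.
exact: sum_le test_le pt lt.
Qed.

Definition add_all_arcs s F := foldt (add_arcs G f h y comb) F s.

(** The fold changes the digraph only through tests that pass, so if it does not
    decrease the number of unreached pairs then every test failed on the initial
    digraph. *)
Lemma add_all_arcs_spec s F :
  F0 \subset F -> F \subset setX G G -> stable F X -> {subset s <= G} ->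
  let r := add_all_arcs s F in
  [/\ r.1 \subset setX G G, stable r.1 X,
      (unreached G r.1 <= unreached G F)%N,
      unreached G r.1 = unreached G F -> forall z, z \in s -> ~~ arc_test F z &
      (r.2 + unreached G r.1 * push_time
        <= size s * test_time + unreached G F * push_time)%N].
Proof.
elim: s F => [|z s IH] F F0F FG sX sG; first by split=> // _ z.
have zG : z \in G by apply: sG; rewrite mem_head.
have sG' : {subset s <= G} by move=> u us; apply: sG; rewrite inE us orbT.
have [FF1 F1G sX1 test1 time1] := add_arcs_spec F0F FG sX zG.
have := IH _ (subset_trans F0F FF1) F1G sX1 sG'.
set F1 := (add_arcs G f h y comb F z).1 in FF1 F1G sX1 test1 time1 *.
case; set r := add_all_arcs s F1 => rG sXr le notest time.
have -> : add_all_arcs (z :: s) F = (r.1, (add_arcs G f h y comb F z).2 + r.2)%N by [].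
have le1 : (unreached G F1 <= unreached G F)%N := unreached_sub G FF1.
split=> //.
- exact: leq_trans le le1.
- move=> req; move: test1; case: ifP => test; 
    first by move=> lt1; have := leq_ltn_trans le lt1; rewrite req ltnn.
  move=> F1E z'; rewrite inE => /orP[/eqP->|]; first by rewrite test.
  by move=> z's; rewrite -F1E; apply: notest z's; rewrite F1E.
- rewrite [size _]/= mulSn.
  have sum_le t1 t2 u0 u1 u2 a d : (t1 + u1 <= a + u0 ->
      t2 + u2 <= d + u1 -> t1 + t2 + u2 <= a + d + u0)%N by clear; lia.
  exact: sum_le time1 time.
Qed.

End AddArcs.

(** * The loop invariant *)

Section Invariant.
Variables (R : realType) (EO : nat) (V : finType).
Notation node := {set V}.
Variable M : {set V}.
Implicit Types (st : state R V) (S X Y A : {set node}) (u v w : node).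

(** M is the least minimizer of the original function and X that of the current
    one.  The bound on the evaluation time says that each of the contractions
    through which an evaluation passes has removed at least one node. *)
Record loop_invariant st X : Prop := LoopInvariant {
  inv_triv : trivIset (ground st);
  inv_nonempty : set0 \notin ground st;
  inv_arcs : arcs st \subset setX (ground st) (ground st);
  inv_sub : submodular (ground st) (fval st);
  inv_set0 : fval st set0 = 0;
  inv_top : fval st (ground st) <= 0;
  inv_card : (#|ground st| <= #|V|)%N;
  inv_time : forall S, ((fn st S).2 + #|ground st| <= EO + #|V|)%N;
  inv_min : least_minimizer (ground st) (fval st) X;
  inv_stable : stable (arcs st) X;
  inv_cover : cover X :|: cover (removed st) = M }.

Lemma coverU (S S' : {set node}) : cover (S :|: S') = cover S :|: cover S'.
Proof. exact: bigcup_setU. Qed.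

(** ** Initialization *)

Lemma mem_cover_singletons (S : {set node}) x :
  S \subset [set [set v] | v : V] -> (x \in cover S) = ([set x] \in S).
Proof.
move=> SG; apply/bigcupP/idP => [[u uS xu]|xS]; last by exists [set x]; rewrite ?set11.
have /imsetP[a _ ua] := subsetP SG _ uS.
by move: xu uS; rewrite ua inE => /eqP ->.
Qed.

Lemma loop_invariant_init (f : {set V} -> R) :
  submodular [set: V] f -> f set0 = 0 -> f [set: V] <= 0 ->
  least_minimizer [set: V] f M ->
  loop_invariant (init EO f) [set [set v] | v in M].
Proof.
move=> sub f0 fT [_ Mmin Mleast]; set G := [set [set v] | v : V].
have covI (S S' : {set node}) : S \subset G -> S' \subset G ->
    cover (S :&: S') = cover S :&: cover S'.
  move=> SG SG'; apply/setP=> x; rewrite inE !mem_cover_singletons ?inE //.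
  exact: subset_trans (subsetIl _ _) SG.
have XG : [set [set v] | v in M] \subset G.
  by apply/subsetP=> u /imsetP[v _ ->]; apply/imsetP; exists v.
have covX : cover [set [set v] | v in M] = M.
  by apply/setP=> x; rewrite mem_cover_singletons // mem_imset //; apply: set1_inj.
split=> //=; rewrite /fval /=.
- apply/trivIsetP=> u w /imsetP[a _ ->] /imsetP[b _ ->] ab.
  by rewrite disjoints1 inE; apply: contra ab => /eqP ->.
- by apply/negP=> /imsetP[a _ /setP/(_ a)]; rewrite !inE eqxx.
- exact: sub0set.
- by move=> S S' SG SG'; rewrite coverU covI //; apply: sub.
- by rewrite /cover big_set0.
- suff -> : cover G = setT by [].
  by apply/setP=> x; rewrite mem_cover_singletons // inE; apply/imsetP; exists x.
- exact: leq_imset_card.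
- by move=> S; rewrite leq_add2l; apply: leq_imset_card.
- split=> // [Y _|Y YG]; rewrite covX; first exact: Mmin.
  move=> /(Mleast _ (subsetT _))/subsetP MY.
  by apply/subsetP=> u /imsetP[v vM ->]; rewrite -mem_cover_singletons ?MY.
- by move=> u w; rewrite inE.
- by rewrite covX /cover big_set0 setU0.
Qed.

(** ** Removing nodes *)

Lemma setDKU (S S' : {set node}) : S \subset S' -> S' :\: S :|: S = S'.
Proof. by move=> SS'; rewrite -{2}(setIidPr SS') setUC setID. Qed.

(** Replacing the value at the whole ground set by its minimum with 0 = f(set0) can
    only add the whole ground set to the minimizers, which does not change the least
    one. *)
Lemma remove_down_spec st X v : loop_invariant st X -> v \in X ->
  let A := down (ground st) (arcs st) [set v] in
  let st' := (remove_down st v).1 in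
  [/\ loop_invariant st' (X :\: A),
      ground st' = ground st :\: A, v \in A,
      (unreached (ground st') (arcs st') <= unreached (ground st) (arcs st))%N &
      ((remove_down st v).2 <= 2 * (EO + #|V|) + 2)%N].
Proof.
move=> [tr ne FG sub f0 fG card time [XG Xmin Xleast] sX cov] vX A st'.
set G := ground st in tr ne FG sub fG time XG Xmin Xleast A *.
have vG : v \in G by apply: (subsetP XG).
have vA : v \in A by apply: (subsetP (sub_down _ _)); rewrite ?inE // sub1set.
have AX : A \subset X by apply: down_min sX; rewrite sub1set.
have AG : A \subset G := subset_trans AX XG.
have sA : stable (arcs st) A by apply: down_stable.
set G' := G :\: A.
have G'A : G' :|: A = G by exact: setDKU.
pose g S := fval st (S :|: A) - fval st A.
have gE S : fval st' S = if S == G' then Num.min 0 (g G') else g S.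
  by rewrite /fval /st' /remove_down /=; case: ifP.
have g0 : g set0 = 0 by rewrite /g set0U subrr.
have leg S : fval st' S <= g S.
  by rewrite gE; case: eqP => [->|//]; rewrite ge_min lexx orbT.
have UG S : S \subset G' -> S :|: A \subset G by move=> SG; rewrite -G'A setSU.
have timeE S : (fn st' S).2 = if S == G' then 0%N else ((fn st (S :|: A)).2 + 1)%N.
  by rewrite /st' /remove_down /=; case: ifP.
have G'lt : (#|G'| < #|G|)%N.
  apply: proper_card; apply/properP; split; first exact: subsetDl.
  by exists v; rewrite // inE vA.
have XA : X :\: A :|: A = X by exact: setDKU.
have X'0 : fval st' (X :\: A) <= 0.
  apply: le_trans (leg _) _; rewrite /g XA subr_le0; exact: Xmin.
split=> //.
- split=> //.
  + exact: trivIsetS (subsetDl _ _) tr.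
  + by apply: contra ne; apply: (subsetP (subsetDl _ _)).
  + exact: subsetIr.
  + move=> S S' SG SG'; have [-> |SN] := eqVneq S G'.
      by rewrite (setIidPr SG') (setUidPl SG') addrC.
    have [-> |SN'] := eqVneq S' G'; first by rewrite (setIidPl SG) (setUidPr SG).
    rewrite [X in _ <= X + _]gE [X in _ <= _ + X]gE (negPf SN) (negPf SN').
    apply: le_trans (lerD (leg _) (leg _)) _; rewrite /g setUIl setUUl.
    have := sub _ _ (UG S SG) (UG S' SG'); lra.
  + by rewrite gE g0; case: eqP => // <-; rewrite g0 minxx.
  + by rewrite gE eqxx ge_min lexx.
  + exact: leq_trans (ltnW G'lt) card.
  + move=> S; rewrite timeE; case: ifP => _.
      exact: leq_trans (ltnW G'lt) (leq_trans (leq_addl _ _) (time set0)).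
    by apply: leq_trans (time (S :|: A)); rewrite -addnA add1n leq_add2l.
  + split; first exact: setSD.
      move=> Y YG; rewrite [leRHS]gE; case: ifP => [_|YN].
        rewrite le_min X'0 /=; apply: le_trans (leg _) _.
        by rewrite /g XA lerB // Xmin ?G'A.
      by apply: le_trans (leg _) _; rewrite /g XA lerB // Xmin ?UG.
    move=> Y YG; rewrite [leLHS]gE; case: ifP => [/eqP -> _|YN]; first exact: setSD.
    move=> le; have : fval st (Y :|: A) <= fval st X.
      have := le_trans le (leg _); rewrite /g XA; lra.
    by move=> /(Xleast _ (UG _ YG)); rewrite subDset setUC.
  + move=> u w; rewrite /st' /= inE => /andP[uw]; rewrite inE /= => /andP[_].
    by rewrite !inE => /andP[/negPf-> _] /andP[_ uX]; rewrite (sX u w).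
  + by rewrite /st' /= setUC coverU -setUA -coverU (setUC A) XA setUC.
- exact: unreached_remove.
- rewrite /remove_down /=; have t1 := time A; have t2 := time (G' :|: A).
  have sum_le a b n m : (a + n <= m -> b + n <= m ->
      a + (b + (1 + (1 + 0))) <= 2 * m + 2)%N by clear; lia.
  exact: sum_le t1 t2.
Qed.

Definition remove_all (y : {ffun node -> R}) (theta : R) st s :=
  foldt (remove_if y theta) st s.

(** The small coordinates lie in the least minimizer X at the start of the loop; as
    the removals delete the same nodes from X and from the ground set, those that
    are left lie in the current least minimizer as well. *)
Lemma remove_all_spec (y : {ffun node -> R}) (theta : R) s st X :
  loop_invariant st X ->
  (forall v, v \in ground st -> y v < theta -> v \in X) ->
  let r := remove_all y theta st s in
  [/\ exists X', loop_invariant r.1 X',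
      ground r.1 \subset ground st,
      forall v, v \in s -> v \in ground r.1 -> theta <= y v,
      (unreached (ground r.1) (arcs r.1) <= unreached (ground st) (arcs st))%N &
      (r.2 <= size s * (2 * (EO + #|V|) + 3))%N].
Proof.
elim: s st X => [|v s IH] st X inv small; first by split=> //; exists X.
set r := remove_all y theta st (v :: s).
have rE : r = ((remove_all y theta (remove_if y theta st v).1 s).1,
  (remove_if y theta st v).2 + (remove_all y theta (remove_if y theta st v).1 s).2)%N by [].
have stay : (remove_if y theta st v).1 = st -> (v \in ground st -> theta <= y v) ->
    ((remove_if y theta st v).2 <= 1)%N -> 
  [/\ exists X', loop_invariant r.1 X',
      ground r.1 \subset ground st,
      forall v', v' \in v :: s -> v' \in ground r.1 -> theta <= y v',
      (unreached (ground r.1) (arcs r.1) <= unreached (ground st) (arcs st))%N &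
      (r.2 <= size (v :: s) * (2 * (EO + #|V|) + 3))%N].
  move=> stE vy t1; rewrite rE stE; have [iX' sub big le time] := IH st X inv small.
  split=> //.
    move=> w; rewrite inE => /orP[/eqP->|]; last exact: big.
    by move=> /(subsetP sub); apply: vy.
  by rewrite [size _]/= mulSn; apply: leq_add time; apply: leq_trans t1 _; rewrite addn3.
have [vG|vG] := boolP (v \in ground st); last first.
  by apply: stay; rewrite /remove_if (negPf vG).
have [yv|yv] := boolP (y v < theta); last first.
  by apply: stay; rewrite /remove_if vG /bind /= ?(negPf yv) // leNgt.
have stE : (remove_if y theta st v) = ((remove_down st v).1, (1 + (remove_down st v).2)%N).
  by rewrite /remove_if vG /bind /= yv.
have [inv' G'E vA le time] := remove_down_spec inv (small v vG yv).
rewrite rE stE /=; set st' := (remove_down st v).1 in inv' G'E le *.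
have small' w : w \in ground st' -> y w < theta ->
    w \in X :\: down (ground st) (arcs st) [set v].
  rewrite G'E inE => /andP[wA wG] yw; by rewrite inE wA small.
have [iX' sub big le' time'] := IH st' _ inv' small'.
have sub' : ground st' \subset ground st by rewrite G'E subsetDl.
split=> //.
- exact: subset_trans sub sub'.
- move=> w; rewrite inE => /orP[/eqP-> /(subsetP sub)|]; last exact: big.
  by rewrite G'E inE vA.
- exact: leq_trans le' le.
- rewrite mulSn; apply: leq_add time'.
  have : (1 + (remove_down st v).2 <= 1 + (2 * (EO + #|V|) + 2))%N.
    by rewrite leq_add2l.
  by rewrite addnCA.
Qed.

End Invariant.

(** * Contracting strongly connected components *)

Section Merge.
Variables (R : realType) (EO : nat) (V : finType).
Notation node := {set V}.
Variable M : {set V}.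
Variables (st : state R V) (X : {set node}).
Hypothesis inv : loop_invariant EO M st X.
Implicit Types (S Y : {set node}) (u v w : node).

Local Notation G := (ground st).
Local Notation F := (arcs st).

Definition merge_node u := cover (component G F u).
Definition preim_merge S := [set u in G | merge_node u \in S].
Definition merged_arcs := [set (merge_node e.1, merge_node e.2) | e in F].

Let st' := merge_components st.

Lemma fval_merge S : fval st' S = fval st (preim_merge S). Proof. by []. Qed.

Lemma component_refl u : u \in G -> u \in component G F u.
Proof. by move=> uG; rewrite inE uG /reach connect0. Qed.

(** Nodes are nonempty and disjoint, so a union of nodes determines them. *)
Lemma cover_inj S S' : S \subset G -> S' \subset G -> cover S = cover S' ->
  S \subset S'.
Proof.
case: inv => tr ne _ _ _ _ _ _ _ _ _ SG SG' SS'; apply/subsetP=> u uS.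
have uG := subsetP SG _ uS.
have [x xu] : exists x, x \in u by apply/set0Pn; apply: contraNneq ne => <-.
have : x \in cover S' by rewrite -SS'; apply/bigcupP; exists u.
case/bigcupP=> w wS' xw; suff -> : u = w by [].
apply/eqP; apply: contraTT xu => uw.
have := trivIsetP tr _ _ uG (subsetP SG' _ wS') uw.
by move=> /pred0P/(_ x) /=; rewrite xw andbT => ->.
Qed.

Lemma component_sub u : component G F u \subset G.
Proof. by apply/subsetP=> w; rewrite inE => /andP[]. Qed.

Lemma merge_reach u w : u \in G -> w \in G -> merge_node u = merge_node w -> reach F u w.
Proof.
move=> uG wG /esym uw.
have := cover_inj (component_sub w) (component_sub u) uw.
by move=> /subsetP/(_ _ (component_refl wG)); rewrite inE => /and3P[].
Qed.

Lemma reach_merge u w : reach F u w -> reach F w u -> merge_node u = merge_node w.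
Proof.
move=> uw wu; rewrite /merge_node; congr cover; apply/setP=> x; rewrite !inE.
congr (_ && _); apply/andP/andP=> -[].
  by move=> ux xu; split; [apply: connect_trans wu ux|apply: connect_trans xu uw].
by move=> wx xw; split; [apply: connect_trans uw wx|apply: connect_trans xw wu].
Qed.

Lemma reach_merged u w : reach F u w -> reach merged_arcs (merge_node u) (merge_node w).
Proof.
case/connectP=> p pP ->; elim: p u pP => [|a p IH] u /=; first by rewrite /reach connect0.
case/andP=> ua /IH; apply: connect_trans; apply: connect1.
by apply/imsetP; exists (u, a).
Qed.

(** A path between merged nodes lifts, since inside a component every node reaches
    every other one. *)
Lemma lift_reach u (n : node) : u \in G -> reach merged_arcs (merge_node u) n ->
  exists w, [/\ w \in G, n = merge_node w & reach F u w].
Proof.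
have FG := inv_arcs inv.
move=> uG /connectP[p]; elim: p u uG => [|a p IH] u uG /=.
  by move=> _ ->; exists u; rewrite /reach connect0.
case/andP=> /imsetP[[b d] bd [ub ->]] pP nE.
have := subsetP FG _ bd; rewrite inE /= => /andP[bG dG].
have [w [wG nw dw]] := IH d dG pP nE; exists w; split=> //.
apply: connect_trans (merge_reach uG bG ub) _.
exact: connect_trans (connect1 _) dw.
Qed.

Lemma reach_closure n n' :
  reach (transitive_closure merged_arcs) n n' = reach merged_arcs n n'.
Proof.
apply/idP/idP.
  by apply: connect_sub => a b; rewrite inE => /andP[].
apply: connect_sub => a b ab; have [->|nab] := eqVneq a b; first exact: connect0.
by apply: connect1; rewrite inE /= nab; apply: connect1.
Qed.

Lemma merged_arcsE n n' :
  ((n, n') \in arcs st') = (n != n') && reach merged_arcs n n'.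
Proof. by rewrite in_set. Qed.

(** Two nodes that reach each other in the contracted digraph come from nodes that
    reach each other, which have been merged. *)
Lemma merged_acyclic : transitive_acyclic (ground st') (arcs st').
Proof.
have FG := inv_arcs inv; split.
- apply/subsetP=> -[n n']; rewrite in_setX merged_arcsE /= => /andP[nn' /connectP[p]].
  elim/last_ind: p => [|p a _]; first by move=> _ /= E; rewrite E eqxx in nn'.
  rewrite last_rcons => pP ->.
  have src : n \in ground st'.
    case: p pP => [|a' p] /= /andP[/imsetP[e eF [-> _]] _]; apply/imsetP; exists e.1 => //;
      by have := subsetP FG _ eF; rewrite inE => /andP[].
  rewrite src; move: pP; rewrite rcons_path => /andP[_ /imsetP[e eF [_ ->]]].
  by apply/imsetP; exists e.2 => //; have := subsetP FG _ eF; rewrite inE => /andP[].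
- by move=> n; rewrite merged_arcsE eqxx.
- have rmerge n n' : (n, n') \in arcs st' -> n \in ground st'.
    rewrite merged_arcsE => /andP[nn' /connectP[[|a p] /=]].
      by move=> _ E; rewrite E eqxx in nn'.
    case/andP=> /imsetP[e eF [-> _]] _ _; apply/imsetP; exists e.1 => //.
    by have := subsetP FG _ eF; rewrite inE => /andP[].
  move=> a b d ab bd; move: (rmerge _ _ ab) (ab) (bd).
  rewrite !merged_arcsE => /imsetP[u uG ->] /andP[nub ub] /andP[_ bd'].
  have ud' : reach merged_arcs (merge_node u) d := connect_trans ub bd'.
  rewrite ud' andbT.
  have [w [wG bE uw]] := lift_reach uG ub.
  apply: contraNneq nub => ud; apply/eqP; rewrite bE.
  apply: reach_merge => //; rewrite bE -ud in bd'.
  have [u' [u'G u'E wu']] := lift_reach wG bd'.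
  by apply: connect_trans wu' _; apply: merge_reach.
Qed.

Lemma unreached_merge :
  (unreached (ground st') (arcs st') <= unreached G F)%N.
Proof.
rewrite /unreached.
pose merge2 (e : node * node) := (merge_node e.1, merge_node e.2).
apply: leq_trans (leq_imset_card merge2 _).
apply: subset_leq_card; apply/subsetP=> -[n n']; rewrite inE in_setX /=.
case/andP=> /andP[/imsetP[u uG ->] /imsetP[w wG ->]] nuw.
apply/imsetP; exists (u, w) => //; rewrite inE in_setX uG wG /=.
by apply: contra nuw => uw; rewrite reach_closure; apply: reach_merged.
Qed.

Lemma merge_loop_invariant : loop_invariant EO M st' [set merge_node u | u in X].
Proof.
have [tr ne FG sub f0 fG card time [XG Xmin Xleast] sX cov] := inv.
have G'le : (#|ground st'| <= #|G|)%N by apply: leq_imset_card.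
have preG : preim_merge (ground st') = G.
  by apply/setP=> u; rewrite inE andb_idr // => uG; apply/imsetP; exists u.
have pre_sub S : preim_merge S \subset G by apply/subsetP=> u; rewrite inE => /andP[].
have preX : preim_merge [set merge_node u | u in X] = X.
  apply/setP=> u; rewrite inE; apply/andP/idP=> [[uG /imsetP[w wX uw]]|uX].
    by apply: reach_stable sX (merge_reach (subsetP XG _ wX) uG (esym uw)) wX.
  by rewrite (subsetP XG) //; split=> //; apply/imsetP; exists u.
have mem_merge u x : (x \in merge_node u) = [exists w in component G F u, x \in w].
  by apply/bigcupP/existsP=> [[w]|[w /andP[]]]; exists w => //; apply/andP.
split.
- apply/trivIsetP=> _ _ /imsetP[u uG ->] /imsetP[w wG ->].
  apply: contraNT => /pred0Pn[x /andP[/=]]; rewrite !mem_merge.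
  case/existsP=> u' /andP[uu' xu'] /existsP[w' /andP[ww' xw']].
  have [u'G w'G] := (subsetP (component_sub _) _ uu', subsetP (component_sub _) _ ww').
  have E : u' = w'.
    apply/eqP; apply: contraTT xu' => uw'.
    by have /pred0P/(_ x) /= := trivIsetP tr _ _ u'G w'G uw'; rewrite xw' andbT => ->.
  move: uu' ww'; rewrite -E !inE => /and3P[_ uu' u'u] /and3P[_ wu' u'w].
  by apply/eqP; apply: etrans (reach_merge uu' u'u) (esym (reach_merge wu' u'w)).
- apply/negP=> /imsetP[u uG].
  rewrite -/(merge_node u) => E.
  have [x xu] : exists x, x \in u by apply/set0Pn; apply: contraNneq ne => <-.
  have : x \in merge_node u by apply/bigcupP; exists u => //; apply: component_refl.
  by rewrite -E inE.
- by case: merged_acyclic.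
- move=> S S' _ _; rewrite !fval_merge.
  have -> : preim_merge (S :&: S') = preim_merge S :&: preim_merge S'.
    by apply/setP=> u; rewrite !inE; case: (u \in G).
  have -> : preim_merge (S :|: S') = preim_merge S :|: preim_merge S'.
    by apply/setP=> u; rewrite !inE; case: (u \in G).
  exact: sub.
- rewrite fval_merge (_ : preim_merge set0 = set0) //.
  by apply/setP=> u; rewrite !inE andbF.
- by rewrite fval_merge preG.
- exact: leq_trans G'le card.
- by move=> S; apply: leq_trans (time (preim_merge S)); rewrite leq_add2l.
- split.
  + by apply/subsetP=> n /imsetP[u uX ->]; apply/imsetP; exists u => //; apply: (subsetP XG).
  + by move=> Y _; rewrite !fval_merge preX; apply: Xmin.
  + move=> Y _; rewrite !fval_merge preX => /(Xleast _ (pre_sub _))/subsetP XY.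
    by apply/subsetP=> n /imsetP[u /XY + ->]; rewrite inE => /andP[].
- move=> n n'; rewrite merged_arcsE => /andP[_ nn'] /imsetP[u uX nE].
  rewrite nE in nn'; have [w [wG -> uw]] := lift_reach (subsetP XG _ uX) nn'.
  by apply/imsetP; exists w => //; apply: reach_stable sX uw uX.
- rewrite -cov; congr (_ :|: _); apply/setP=> x; apply/bigcupP/bigcupP.
    case=> _ /imsetP[u uX ->]; rewrite mem_merge => /existsP[w /andP[]].
    rewrite inE => /and3P[_ uw _] xw; exists w => //.
    exact: reach_stable sX uw uX.
  case=> u uX xu; exists (merge_node u); first by apply/imsetP; exists u.
  by rewrite mem_merge; apply/existsP; exists u; rewrite component_refl // (subsetP XG).
Qed.

End Merge.

(** * One pass and the whole run *)

(** The time of one pass for N nodes and evaluations taking time b, apart from the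
    call of the oracle and from the pushes; the terms are for ell, ell^-, the loop
    condition, the tests for new arcs, the threshold, and the removals. *)
Definition pass_time (b N : nat) : nat :=
  (N * (2 * b + 1) + 2 * N + 1 + N * test_time b N + 2 + N * (2 * b + 3))%N.

Lemma leq_pass_time b N m : (N <= m)%N -> (pass_time b N <= pass_time b m)%N.
Proof.
move=> Nm; rewrite /pass_time /test_time.
by do ![apply: leq_add | apply: leq_mul | exact: leqnn | done].
Qed.

Section Run.
Variables (R : realType) (O : sfm_oracle R) (c EO : nat) (V : finType).
Notation node := {set V}.
Variables (f : {set V} -> R) (M : {set V}).
Hypothesis OP : is_approx_sfm c O.
Implicit Types (st : state R V) (X : {set node}).

Local Notation n := #|V|.
Local Notation delta := (1 / (3 * n%:R ^+ 3) : R).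
Local Notation b := (EO + n)%N.
Local Notation PT := (push_time c b n).

Definition pot st := potential (ground st) (arcs st).

Definition oracle_time st : nat :=
  (O (ground st) (fdown (ground st) (arcs st) (fval st)) delta).2.

Local Notation BT := (pass_time b n).

Lemma iteration_stop st X : loop_invariant EO M st X ->
  transitive_acyclic (ground st) (arcs st) ->
  0 <= neg_sum (ell (ground st) (arcs st) (fval st)) (ground st) ->
  [/\ (iteration O delta st).1 = None, cover (removed st) = M &
      ((iteration O delta st).2 <= BT)%N].
Proof.
move=> inv ac l0.
have [_ _ _ sub f0 _ card time Xmin sX cov] := inv.
have X0 := least_minimizer_stop ac sub f0 Xmin sX l0.
set G := ground st in ac l0 sub card Xmin *; set F := arcs st in ac l0 *.
pose l := ellt G F (fn st); pose lneg := neg_sumt l.1 G.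
have [ln lt] : lneg.1 = neg_sum l.1 G /\ lneg.2 = (2 * #|G|)%N by exact: neg_sumtE.
have -> : iteration O delta st = (None, l.2 + (lneg.2 + (1 + 0)))%N.
  rewrite /iteration {1}/bind -/G -/F -/l; have /negPf E : ~~ (lneg.1 < 0).
    by rewrite ln neg_sum_ellt // -leNgt.
  by rewrite /bind [X in if X then _ else _]E.
split=> //; first by rewrite -cov X0 /cover big_set0 set0U.
rewrite lt.
have lb : (l.2 <= #|G| * (2 * b + 1))%N.
  by apply: ellt_time => S; apply: leq_trans (time S); apply: leq_addr.
apply: leq_trans (leq_pass_time b card); rewrite /pass_time.
have sum_le a u p q r s t : (a <= u -> a + (p + (1 + 0)) <= u + p + 1 + q + r + s)%N.
  by clear; lia.
exact: sum_le lb.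
Qed.

(** If the potential did not decrease then no test passed on the initial digraph and
    no node was removed, so no coordinate of y was small; this contradicts
    test_passes. *)
Lemma iteration_step st X : loop_invariant EO M st X ->
  transitive_acyclic (ground st) (arcs st) ->
  neg_sum (ell (ground st) (arcs st) (fval st)) (ground st) < 0 ->
  exists st' X',
  [/\ (iteration O delta st).1 = Some st', loop_invariant EO M st' X',
      transitive_acyclic (ground st') (arcs st'), (pot st' < pot st)%N &
      ((iteration O delta st).2 + pot st' * PT
         <= oracle_time st + BT + pot st * PT)%N].
Proof.
move=> inv ac l0.
have [tr ne FG sub f0 fG card time Xmin sX cov] := inv.
have [XG Xle _] := Xmin.
rewrite /oracle_time /pot.
set G := ground st in tr ne FG ac l0 sub fG card time Xmin XG Xle *.
set F := arcs st in FG ac l0 sX *.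
set out := O G _ delta.
pose y := sfm_base out.1; pose comb := sfm_comb out.1.
pose l := ellt G F (fn st); pose lneg := neg_sumt l.1 G.
pose F' := add_all_arcs G (fn st) y comb (fdownt G F (fn st) l.1) (enum G) F.
pose theta : R := 2 * lneg.1 * delta.
pose st1 := State G (fn st) F'.1 (removed st).
pose r := remove_all y theta st1 (enum G).
have [lnt lt] : lneg.1 = neg_sum l.1 G /\ lneg.2 = (2 * #|G|)%N by exact: neg_sumtE.
have ln : lneg.1 = neg_sum (ell G F (fval st)) G by rewrite lnt neg_sum_ellt.
have -> : iteration O delta st =
   (Some (merge_components r.1),
    l.2 + (lneg.2 + (1 + (out.2 + (F'.2 + (1 + (1 + (r.2 + 0))))))))%N.
  rewrite /iteration {1}/bind -/G -/F -/l; have E : lneg.1 < 0 by rewrite ln.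
  by rewrite /bind [X in if X then _ else _]E.
have G0 : G != set0 by apply: contraTneq l0 => ->; rewrite /neg_sum big_set0 ltxx.
have N0 : (0 < n)%N by apply: leq_trans card; rewrite card_gt0.
have d0 : 0 < delta by rewrite divr_gt0 // mulr_gt0 // exprn_gt0 // ltr0n.
have subd := fdown_submodular ac sub.
have [WG [yB [combc [combP [comb1 [yE Wopt]]]]]] := OP G0 subd (fdown0 _ _ f0) d0.
have fb S : ((fn st S).2 <= b)%N by apply: leq_trans (time S); apply: leq_addr.
have fX : fval st X <= 0 := least_minimizer_le0 f0 Xmin.
have sG : {subset enum G <= G} by move=> u; rewrite mem_enum.
have hE S : (fdownt G F (fn st) l.1 S).1 = fdown G F (fval st) S by exact: fdown_fdownt.
have hb S : ((fdownt G F (fn st) l.1 S).2 <= b + 2 * #|G| + 1)%N by exact: fdownt_time.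
have [F'G sX' uF' notest F'time] :=
  add_all_arcs_spec hE hb ac sub f0 fb combc combP comb1 yE XG fX (subxx F) FG sX sG.
rewrite -/F' in F'G sX' uF' notest F'time.
have inv1 : loop_invariant EO M st1 X by split.
have small v : v \in ground st1 -> y v < theta -> v \in X.
  rewrite /theta ln.
  exact: (small_coordinate_in_minimizer ac sub fG d0 WG yB Wopt sX XG Xle).
have [[X' inv'] rG big ur rtime] :=
  @remove_all_spec _ _ _ _ y theta (enum G) st1 X inv1 small.
rewrite -/r in inv' rG big ur rtime.
exists (merge_components r.1), [set merge_node r.1 u | u in X'].
have ptle : (potential (ground (merge_components r.1)) (arcs (merge_components r.1))
    <= unreached (ground r.1) (arcs r.1) + #|ground r.1|)%N.
  by apply: leq_add; [exact: unreached_merge|apply: leq_imset_card].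
have cr : (#|ground r.1| <= #|G|)%N := subset_leq_card rG.
have ptle' : (potential (ground (merge_components r.1)) (arcs (merge_components r.1))
    <= unreached G F'.1 + #|G|)%N.
  by apply: leq_trans ptle _; apply: leq_add cr.
split=> //.
- exact: merge_loop_invariant.
- exact: merged_acyclic inv'.
- rewrite ltn_neqAle (leq_trans ptle') ?leq_add2r // andbT.
  apply/negP=> /eqP pE.
  have [uE cE] : unreached G F'.1 = unreached G F /\ #|G| = #|ground r.1|.
    move: ptle ur uF' cr; rewrite pE /potential.
    have sum_eq a k p q x : (a + k <= p + q -> p <= x -> x <= a -> q <= k ->
        x = a /\ k = q)%N.
      by clear; split; lia.
    exact: sum_eq.
  have rGE : ground r.1 = G by apply/eqP; rewrite eqEcard rG cE /=.
  have ybig v : v \in G -> 2 * neg_sum (ell G F (fval st)) G * delta <= y v.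
    by move=> vG; rewrite -ln; apply: big; rewrite ?mem_enum // rGE.
  have [z zG zt] := test_passes ac sub card yB l0 ybig.
  by have := notest uE z; rewrite mem_enum => /(_ zG); rewrite /arc_test zt.
- rewrite lt; move: F'time rtime; rewrite -cardE => F'time rtime.
  have lb : (l.2 <= #|G| * (2 * b + 1))%N by exact: ellt_time.
  have pass_le := leq_pass_time b card.
  have push_le := leq_push_time c b card.
  set p' := potential (ground (merge_components r.1)) _ in ptle' *.
  set p := potential G F.
  have pushes : (F'.2 + p' * PT <= #|G| * test_time b #|G| + p * PT)%N.
    have arith t t0 N u u' q q' s : (t + u' * q <= t0 + u * q -> u' <= u -> q <= q' ->
        s <= u' + N -> t + s * q' <= t0 + (u + N) * q')%N.
      clear=> h1 h2 h3 h4.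
      have [d uE] : exists d, u = (u' + d)%N by exists (u - u')%N; lia.
      have h5 : (d * q <= d * q')%N by rewrite leq_mul2l h3 orbT.
      have h6 : (s * q' <= (u' + N) * q')%N by rewrite leq_mul2r h4 orbT.
      by move: h1 h5 h6; rewrite uE !mulnDl; clear; lia.
    exact: arith F'time uF' push_le ptle'.
  have sum_le a a' m w x x' z z' s s' B : (a <= a' -> x + z' <= x' + z -> s <= s' ->
      a' + m + 1 + x' + 2 + s' <= B ->
      a + (m + (1 + (w + (x + (1 + (1 + (s + 0))))))) + z' <= w + B + z)%N by clear; lia.
  exact: sum_le lb pushes rtime pass_le.
Qed.

(** By induction on the potential: each of the at most pot st passes accounts for one
    call of the oracle and one pass_time, each unit of potential for at most one
    push_time, and the last summand for the final test of the loop condition. *)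
Lemma run_spec st X : reached O EO f delta st -> loop_invariant EO M st X ->
  transitive_acyclic (ground st) (arcs st) ->
  exists t, runs O delta st M t /\
    forall r : R,
      (forall st', reached O EO f delta st' ->
        transitive_acyclic (ground st') (arcs st') -> (oracle_time st')%:R <= r) ->
      t%:R <= (pot st)%:R * r + (pot st * (BT + PT) + BT)%:R.
Proof.
have [m] := ubnP (pot st); elim: m st X => [//|m IH] st X pm re inv ac.
have [l0|l0] := leP 0 (neg_sum (ell (ground st) (arcs st) (fval st)) (ground st)).
  have [itE cR tle] := iteration_stop inv ac l0; exists (iteration O delta st).2; split.
    by rewrite -cR; apply: runs_stop; rewrite -itE -surjective_pairing.
  move=> r rP; have r0 : 0 <= r by apply: le_trans (rP st re ac).
  rewrite -[leLHS]add0r lerD ?mulr_ge0 ?ler0n // ler_nat //;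
    by apply: leq_trans tle _; apply: leq_addl.
have [st' [X' [itE inv' ac' lt tle]]] := iteration_step inv ac l0.
have re' : reached O EO f delta st' by apply: reached_step re itE.
have [t [rt tb]] := IH st' X' (leq_trans lt pm) re' inv' ac'.
exists ((iteration O delta st).2 + t)%N; split.
  by apply: runs_step rt; rewrite -itE -surjective_pairing.
move=> r rP; have r0 : 0 <= r by apply: le_trans (rP st re ac).
move: tle (rP st re ac) (tb r rP) lt.
move: (iteration O delta st).2 (pass_time b n) (push_time c b n) (oracle_time st).
move: (pot st) (pot st') => p p' t' B P a.
rewrite -(ler_nat R) -(ler_nat R p'.+1) -natr1 !natrD !natrM !natrD => tle ar tb' pp.
have pr : (p'%:R + 1) * r <= p%:R * r by rewrite ler_wpM2r.
have pB : (p'%:R + 1) * B%:R <= p%:R * B%:R :> R by apply: ler_wpM2r pp; exact: ler0n.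
lra.
Qed.

End Run.

(** * The running time bound *)

Definition time_constant (c : nat) : nat := (22 * c + 65)%N.

Lemma time_bound c EO n p : (0 < n)%N -> (p <= 2 * n ^ 2)%N ->
  (p * (pass_time (EO + n) n + push_time c (EO + n) n) + pass_time (EO + n) n
    <= time_constant c * (n ^ 4 * EO + n ^ 5))%N.
Proof.
move=> n0 pn; set q := (EO + n)%N.
have BE : (pass_time (EO + n) n <= 19 * (n * q))%N.
  by rewrite /pass_time /test_time /q; nia.
have nq : (n * q <= n ^ 2 * q)%N by rewrite leq_mul2r -mulnn leq_pmull // orbT.
have n2 : (n <= n ^ 2)%N by rewrite -mulnn leq_pmull.
have PE : (push_time c q n <= (11 * c + 4) * (n ^ 2 * q))%N.
  have q1 : (n <= q)%N by apply: leq_addl.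
  have q0 : (0 < q)%N by apply: leq_trans q1.
  have a1 : (2 * (q + 2 * n + 1) + 1 <= 9 * q)%N by lia.
  have a2 : (c * n * (n * (2 * (q + 2 * n + 1) + 1)) <= 9 * (c * (n ^ 2 * q)))%N.
    apply: leq_trans (_ : c * n * (n * (9 * q)) <= _)%N; first by rewrite !leq_mul2l a1 !orbT.
    by apply: eq_leq; rewrite -mulnn; lia.
  have a3 : (n * (2 * (c * n)) <= 2 * (c * (n ^ 2 * q)))%N.
    rewrite (_ : n * (2 * (c * n)) = 2 * (c * n ^ 2))%N; last by rewrite -mulnn; lia.
    by rewrite !leq_mul2l leq_pmulr // !orbT.
  have a4 : (3 * n + 1 <= 4 * (n ^ 2 * q))%N.
    have : (n <= n ^ 2 * q)%N by apply: leq_trans n2 _; rewrite leq_pmulr.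
    lia.
  by rewrite /push_time mulnDl -mulnA; lia.
have E : (n ^ 4 * EO + n ^ 5 = n ^ 2 * (n ^ 2 * q))%N.
  by rewrite (expnSr n 4) -mulnDr -/q mulnA -expnD.
rewrite E; move: (pass_time _ _) (push_time _ _ _) BE PE => B P BE PE.
have BP : (p * (B + P) <= 2 * n ^ 2 * ((11 * c + 23) * (n ^ 2 * q)))%N.
  by apply: leq_mul => //; move: (n ^ 2 * q)%N BE nq PE => x; lia.
have Bq : (B <= 19 * (n ^ 2 * (n ^ 2 * q)))%N.
  apply: leq_trans BE _; rewrite leq_mul2l; apply: leq_trans nq _.
  by rewrite leq_pmull // expn_gt0 n0.
apply: leq_trans (leq_add BP Bq) _; rewrite /time_constant.
move: (n ^ 2)%N => m; clear; lia.
Qed.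

Theorem theorem4p7 (c : nat) :
  exists C : nat,
    forall (R : realType) (O : sfm_oracle R) (EO : nat) (V : finType)
           (f : {set V} -> R),
      is_approx_sfm c O ->
      submodular [set: V] f ->
      f set0 = 0 ->
      f [set: V] <= 0 ->
      let n := #|V| in
      let delta : R := 1 / (3 * n%:R ^+ 3) in
      exists (S : {set V}) (t : nat),
        [/\ runs O delta (init EO f) S t,
            unique (minimal_minimizer f) S &
            (0 < n)%N ->
            (t%:R%:E <=
               C%:R%:E * ((n ^ 2)%:R%:E * AOdown O EO f delta
                          + (n ^ 4 * EO + n ^ 5)%:R%:E))%E].
Proof.
exists (time_constant c) => R O EO V f OP sub f0 fT n delta.
have [M Mleast] := ex_least_minimizer sub.
have inv := loop_invariant_init EO sub f0 fT Mleast.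
have ac : transitive_acyclic (ground (init EO f)) (arcs (init EO f)).
  by split=> [|u|u v w]; rewrite ?sub0set ?inE.
have re : reached O EO f delta (init EO f) by apply: reached_init.
have [t [rt tb]] := run_spec OP re inv ac.
have [_ Mmin Mle] := Mleast.
have Mm : minimizer f M by move=> X; apply: Mmin; apply: subsetT.
exists M, t; split=> // [|n0].
  split=> [|S [Sm Smin]].
    split=> // X Xm XM; apply/eqP; rewrite eqEsubset XM.
    by apply: Mle (subsetT _) (Xm M).
  by apply: Smin Mm _; apply: Mle (subsetT _) (Sm M).
have ub st : reached O EO f delta st -> transitive_acyclic (ground st) (arcs st) ->
    ((oracle_time O st)%:R%:E <= AOdown O EO f delta)%E.
  by move=> re' ac'; apply: ereal_sup_ubound; exists st, (arcs st).
have p0 : (pot (init EO f) <= 2 * n ^ 2)%N.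
  apply: leq_trans (potential_le _ _) _.
  by rewrite leq_mul2l leq_exp2r // (inv_card inv).
have tB := time_bound c EO n0 p0.
move: ub; case: (AOdown O EO f delta) => [r||] ub.
- rewrite -!EFinM lee_fin.
  have ub' st : reached O EO f delta st -> transitive_acyclic (ground st) (arcs st) ->
    (oracle_time O st)%:R <= r by move=> re' ac'; rewrite -lee_fin; apply: ub.
  have r0 : 0 <= r by apply: le_trans (ub' _ re ac).
  apply: le_trans (tb r ub') _; rewrite mulrDr mulrA -natrM -[X in _ <= _ + X]natrM.
  apply: lerD; last by rewrite ler_nat.
  rewrite ler_wpM2r // ler_nat; apply: leq_trans p0 _.
  by rewrite leq_mul2r /time_constant; apply/orP; right; lia.
- have C0 : (0 < (time_constant c)%:R%:E :> \bar R)%E.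
    by rewrite lte_fin ltr0n /time_constant addn_gt0 orbT.
  have n20 : (0 < (n ^ 2)%:R%:E :> \bar R)%E by rewrite lte_fin ltr0n expn_gt0 n0.
  by rewrite gt0_muley // addye // gt0_muley // leey.
- by have := ub _ re ac; rewrite leeNy_eq.
Qed.
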